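(* Let $b\ge2$ be an integer, $\lambda\in(1/b,1)$, and let $\phi$ be a real analytic $\mathbb{Z}$-periodic function satisfying condition (H). Then there exist positive integers $\ell_0,Q_0$ and a constant $\rho_0>0$ such that for every $n\in\mathbb{Z}_+$ and all $\mathbf{u},\mathbf{v}\in\Sigma$ with $u_n\ne v_n$: $\sup_{x\in[0,1)}|Y(x,\mathbf{u})-Y(x,\mathbf{v})|\ge\rho_0 b^{-Q_0n}$, and $\sum_{I\in\mathcal{L}_{\ell_0},\,I\subset[0,1)}\ \inf_{x\in I}|Y(x,\mathbf{u})-Y(x,\mathbf{v})|\ \ge\ \rho_0\sup_{x\in[0,1]}|Y(x,\mathbf{u})-Y(x,\mathbf{v})|.$
   Context: $\Lambda=\{0,\dots,b-1\}$, $\Sigma=\Lambda^{\mathbb{Z}_+}$, $\mathbf{u}=u_1u_2\cdots$. $\gamma=1/(b\lambda)$, $Y(x,\mathbf{j})=-\sum_{n\ge1}\gamma^n\phi'\!\left(\frac{x}{b^n}+\frac{j_1}{b^n}+\frac{j_2}{b^{n-1}}+\cdots+\frac{j_n}{b}\right)$ (this is the derivative of $\Gamma_{\mathbf{j}}(x)=\int_0^xY(t,\mathbf{j})dt$). Condition (H): $Y(\cdot,\mathbf{j})-Y(\cdot,\mathbf{i})\not\equiv0$ for all $\mathbf{i}\ne\mathbf{j}\in\Sigma$. $\mathcal{L}_\ell$ is the partition of $\mathbb{R}$ into intervals $[j/b^\ell,(j+1)/b^\ell)$, $j\in\mathbb{Z}$. *)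

(* Defs.v *)
From Stdlib Require Import Reals.
From Coquelicot Require Import Coquelicot.
Open Scope R_scope.

Definition real_analytic (f : R -> R) : Prop :=
  forall x0 : R, exists r : R, 0 < r /\ exists a : nat -> R,
    forall x : R, Rabs (x - x0) < r -> is_pseries a (x - x0) (f x).

Definition Z_periodic (f : R -> R) : Prop := forall x : R, f (x + 1) = f x.

(* Sequences j = j_1 j_2 ... in Sigma = {0,...,b-1}^{Z_+} are encoded as
   j : nat -> nat with j k = j_k for k >= 1; the unused coordinate j 0 is
   normalised to 0 so that equality of encodings is equality in Sigma. *)
Definition inSigma (b : nat) (j : nat -> nat) : Prop :=
  j 0%nat = 0%nat /\ forall k : nat, (j k < b)%nat.

Definition Yarg (b : nat) (x : R) (j : nat -> nat) (n : nat) : R :=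
  x / (INR b) ^ n + sum_n_m (fun k => INR (j k) / (INR b) ^ (n + 1 - k)) 1 n.

Definition Y (b : nat) (lambda : R) (phi : R -> R) (x : R) (j : nat -> nat) : R :=
  - Series (fun m => (/ (INR b * lambda)) ^ (S m) * Derive phi (Yarg b x j (S m))).

Definition condH (b : nat) (lambda : R) (phi : R -> R) : Prop :=
  forall i j : nat -> nat, inSigma b i -> inSigma b j -> i <> j ->
    ~ (forall x : R, Y b lambda phi x j - Y b lambda phi x i = 0).

Definition dY (b : nat) (lambda : R) (phi : R -> R) (u v : nat -> nat) (x : R) : R :=
  Rabs (Y b lambda phi x u - Y b lambda phi x v).

Definition sup_co01 (f : R -> R) : Rbar :=
  Lub_Rbar (fun y => exists x, 0 <= x < 1 /\ y = f x).
Definition sup_cc01 (f : R -> R) : Rbar :=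
  Lub_Rbar (fun y => exists x, 0 <= x <= 1 /\ y = f x).

Definition inf_co (f : R -> R) (a c : R) : Rbar :=
  Glb_Rbar (fun y => exists x, a <= x < c /\ y = f x).

(* Sum over the intervals I = [j/b^l, (j+1)/b^l) of L_l contained in [0,1),
   i.e. j = 0, ..., b^l - 1, of inf_{x in I} f x.  (The infima below are of
   nonnegative functions over nonempty sets, hence finite.) *)
Definition sum_inf_Ll (b l : nat) (f : R -> R) : R :=
  sum_n (fun j => real (inf_co f (INR j / (INR b) ^ l) (INR (S j) / (INR b) ^ l)))
        (b ^ l - 1)%nat.

(* Main.v *)
Require Import Defs.
From Stdlib Require Import Reals ZArith Lra Lia Classical IndefiniteDescription List.
From Coquelicot Require Import Coquelicot.
Open Scope R_scope.

(* Periodicity and compactness make phi' uniformly analytic, so all the functions Y(., w)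
   have Taylor expansions with the same geometric bounds.  By compactness of Sigma and [0,1],
   condition (H) and the identity theorem, there are Q and c > 0 such that, whenever w and w'
   differ in the first letter, every point of [0,1] carries a Taylor coefficient of
   Y(., w) - Y(., w') of order at most Q and modulus at least c.  If u and v first differ at
   the letter n + 1, then Y(x, u) - Y(x, v) = gamma^n (Y(y, w) - Y(y, w')) where
   y = q + x / b^n and w, w' differ in the first letter.
   Comparison with the Taylor polynomial of degree Q at q bounds the supremum of the
   difference from below by a power of b^-n, and shows that on a scale independent of n, u, v
   the difference oscillates by at most half of its supremum.  Hence it stays above a quarter
   of the supremum on one whole interval of the partition. *)

(** * Elementary bounds: geometric series and polynomial coefficients *)

Lemma ex_series_geom_dominated (g : nat -> R) (G q : R) :
  0 <= q < 1 -> (forall m, Rabs (g m) <= G * q ^ m) -> ex_series g.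
Proof.
  intros Hq Hg.
  apply (@ex_series_le R_AbsRing R_CompleteNormedModule g (fun m => G * q ^ m)); [exact Hg|].
  apply (@ex_series_scal_l R_AbsRing).
  exists (/ (1 - q)); apply is_series_geom; rewrite Rabs_pos_eq; lra.
Qed.

Lemma Series_geom_dominated (g : nat -> R) (G q : R) :
  0 <= q < 1 -> (forall m, Rabs (g m) <= G * q ^ m) ->
  Rabs (Series g) <= G / (1 - q).
Proof.
  intros Hq Hg.
  assert (HS : Series (fun m => G * q ^ m) = G / (1 - q)).
  { rewrite Series_scal_l. rewrite (is_series_unique _ (/ (1 - q))); [reflexivity|].
    apply is_series_geom; rewrite Rabs_pos_eq; lra. }
  assert (HE : ex_series (fun m => G * q ^ m)).
  { apply (@ex_series_scal_l R_AbsRing).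
    exists (/ (1 - q)); apply is_series_geom; rewrite Rabs_pos_eq; lra. }
  rewrite <- HS.
  apply Rle_trans with (Series (fun m => Rabs (g m))).
  - apply Series_Rabs.
    apply (ex_series_geom_dominated _ G q Hq).
    intros m; rewrite Rabs_Rabsolu; apply Hg.
  - apply Series_le; [|exact HE].
    intros m; split; [apply Rabs_pos | apply Hg].
Qed.

Lemma sum_f_R0_const_bound (a : nat -> R) (B : R) (Q : nat) :
  (forall k, (k <= Q)%nat -> a k <= B) -> sum_f_R0 a Q <= INR (S Q) * B.
Proof.
  intros H; induction Q as [|Q IH].
  - simpl. specialize (H 0%nat (le_n _)). lra.
  - rewrite S_INR. simpl sum_f_R0.
    assert (sum_f_R0 a Q <= INR (S Q) * B) by (apply IH; intros; apply H; lia).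
    specialize (H (S Q) (le_n _)). lra.
Qed.

(* Passing from [P t] to [P t - 2^Q * P (t / 2)] kills the top coefficient and
   multiplies the others by factors of modulus at least 1. *)
Lemma poly_coef_bound (Q : nat) :
  exists C : R, 0 < C /\ forall (a : nat -> R) (B : R),
    (forall t, 0 <= t <= 1 -> Rabs (sum_f_R0 (fun k => a k * t ^ k) Q) <= B) ->
    forall k, (k <= Q)%nat -> Rabs (a k) <= C * B.
Proof.
  induction Q as [|Q [C [HC IH]]].
  - exists 1; split; [lra|]. intros a B H k Hk.
    replace k with 0%nat by lia.
    specialize (H 0 ltac:(lra)). simpl in H. rewrite Rmult_1_r in H. lra.
  - set (T := 2 ^ S Q).
    assert (HT : 0 < T) by (apply pow_lt; lra).
    exists (C * (1 + T) + 1 + INR (S Q) * (C * (1 + T))).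
    assert (HQ : 0 <= INR (S Q)) by apply pos_INR.
    assert (HCT : 0 < C * (1 + T)) by (apply Rmult_lt_0_compat; lra).
    split; [nra|].
    intros a B H.
    assert (HB : 0 <= B).
    { apply Rle_trans with (2 := H 0 ltac:(lra)); apply Rabs_pos. }
    assert (Hlow : forall k, (k <= Q)%nat -> Rabs (a k) <= C * (1 + T) * B).
    { intros k Hk.
      apply Rle_trans with (Rabs (a k * (1 - 2 ^ (S Q - k)))).
      - rewrite Rabs_mult. rewrite <- (Rmult_1_r (Rabs (a k))) at 1.
        apply Rmult_le_compat_l; [apply Rabs_pos|].
        replace (S Q - k)%nat with (S (Q - k)) by lia.
        assert (1 <= 2 ^ (Q - k)) by (apply pow_R1_Rle; lra).
        simpl. rewrite Rabs_minus_sym, Rabs_pos_eq; lra.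
      - rewrite Rmult_assoc.
        apply (IH (fun k => a k * (1 - 2 ^ (S Q - k)))); [|exact Hk].
        intros t Ht.
        replace (sum_f_R0 (fun k0 => a k0 * (1 - 2 ^ (S Q - k0)) * t ^ k0) Q) with
          (sum_f_R0 (fun k => a k * t ^ k) (S Q) - T * sum_f_R0 (fun k => a k * (t / 2) ^ k) (S Q)).
        + assert (H1 := H t Ht). assert (H2 := H (t / 2) ltac:(lra)).
          apply Rabs_le_between in H1. apply Rabs_le_between in H2.
          apply Rabs_le_between. nra.
        + rewrite scal_sum, <- minus_sum. simpl sum_f_R0 at 1.
          replace (a (S Q) * (t * t ^ Q) - a (S Q) * (t / 2 * (t / 2) ^ Q) * T) with 0.
          2:{ change (0 = a (S Q) * t ^ S Q - a (S Q) * (t / 2) ^ S Q * T).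
              unfold T, Rdiv. rewrite Rpow_mult_distr, pow_inv. field. apply pow_nonzero; lra. }
          rewrite Rplus_0_r. apply sum_eq. intros i Hi.
          unfold Rdiv. rewrite Rpow_mult_distr, pow_inv.
          unfold T. replace (2 ^ S Q) with (2 ^ (S Q - i) * 2 ^ i).
          2:{ rewrite <- pow_add. f_equal; lia. }
          field. apply pow_nonzero; lra. }
    intros k Hk.
    destruct (Nat.eq_dec k (S Q)) as [->|Hne].
    (* The top coefficient, killed in the recursion, is recovered at t = 1, where the polynomial is
       the sum of its coefficients. *)
    + assert (H1 := H 1 ltac:(lra)). simpl sum_f_R0 in H1. rewrite pow1, !Rmult_1_r in H1.
      assert (H2 : Rabs (sum_f_R0 (fun k => a k * 1 ^ k) Q) <= INR (S Q) * (C * (1 + T) * B)).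
      { eapply Rle_trans; [apply Rsum_abs|].
        apply sum_f_R0_const_bound. intros i Hi. rewrite pow1, Rmult_1_r. auto. }
      replace (a (S Q)) with ((sum_f_R0 (fun k : nat => a k * 1 ^ k) Q + a (S Q))
         - sum_f_R0 (fun k : nat => a k * 1 ^ k) Q) by ring.
      eapply Rle_trans; [apply Rabs_triang|]. rewrite Rabs_Ropp. nra.
    + assert (Hk' := Hlow k ltac:(lia)). 
      assert (0 <= INR (S Q) * (C * (1 + T))) by (apply Rmult_le_pos; lra). nra.
Qed.

(** * Cauchy-type derivative bounds for a periodic analytic function *)

(** Binomial coefficients of m + k are at most 2^(m+k); the induction is Pascal's rule, with
    denominators cleared. *)
Lemma fact_add_le (m k : nat) :
  (Factorial.fact (m + k) <= Factorial.fact m * Factorial.fact k * 2 ^ (m + k))%nat.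
Proof.
  remember (m + k)%nat as s eqn:Hs. revert m k Hs.
  induction s as [|s IH]; intros m k Hs.
  - replace m with 0%nat by lia. replace k with 0%nat by lia. simpl; lia.
  - assert (H2 : (1 <= 2 ^ S s)%nat) by (assert (H:= Nat.pow_nonzero 2 (S s)); lia).
    destruct m as [|m].
    { replace k with (S s) by lia. change (Factorial.fact 0) with 1%nat. nia. }
    destruct k as [|k].
    { replace (S m) with (S s) by lia. change (Factorial.fact 0) with 1%nat. nia. }
    assert (H3 := IH m (S k) ltac:(lia)). assert (H4 := IH (S m) k ltac:(lia)).
    rewrite Nat.pow_succ_r'. rewrite !fact_simpl in *. rewrite Hs.
    revert H3 H4. generalize (Factorial.fact s) (Factorial.fact m) (Factorial.fact k) (2 ^ s)%nat.
    intros; nia.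
Qed.

(** Termwise differentiation produces (m+n)!/m! <= n! 2^(m+n). On the radius rho/4 the factor 2^m
    still leaves a geometric series of ratio 1/2, whose sum is the factor 2 in the bound. *)
Lemma PS_derive_n_PSeries_bound (a : nat -> R) (A rho : R) :
  0 < rho -> (forall k, Rabs (a k) * rho ^ k <= A) ->
  forall (n : nat) (h : R), Rabs h < rho / 4 ->
  ex_derive_n (PSeries a) n h /\
  Rabs (Derive_n (PSeries a) n h) <= 2 * A * INR (Factorial.fact n) * (2 / rho) ^ n.
Proof.
  intros Hrho Ha n h Hh.
  assert (Hcv : Rbar_lt (Rabs h) (CV_radius a)).
  { apply Rbar_lt_le_trans with rho; [simpl; lra|].
    apply (proj1 (CV_radius_bounded a)). exists A. intros k.
    rewrite Rabs_mult, (Rabs_pos_eq (rho ^ k)); [apply Ha | apply pow_le; lra]. }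
  split; [apply ex_derive_n_PSeries; exact Hcv|].
  rewrite Derive_n_PSeries by exact Hcv.
  unfold PSeries.
  replace (2 * A * INR (Factorial.fact n) * (2 / rho) ^ n)
    with ((A * INR (Factorial.fact n) * (2 / rho) ^ n) / (1 - / 2)) by (field; lra).
  apply Series_geom_dominated; [lra|].
  intros m. unfold PS_derive_n.
  assert (Hf := fact_add_le m n). apply le_INR in Hf. rewrite !mult_INR, pow_INR in Hf.
  change (INR 2) with 2 in Hf.
  assert (Hm := INR_fact_lt_0 m). assert (Hn := INR_fact_lt_0 n). assert (Hmn := INR_fact_lt_0 (m + n)).
  assert (Hp : 0 < rho ^ (m + n)) by (apply pow_lt; lra).
  assert (H1 : Rabs (a (m + n)%nat) <= A * / rho ^ (m + n)).
  { apply (Rmult_le_reg_r (rho ^ (m + n))); [exact Hp|].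
    rewrite Rmult_assoc, Rinv_l by lra. rewrite Rmult_1_r. apply Ha. }
  assert (H2 : INR (Factorial.fact (m + n)) / INR (Factorial.fact m) <= INR (Factorial.fact n) * 2 ^ (m + n)).
  { apply (Rmult_le_reg_r (INR (Factorial.fact m))); [exact Hm|].
    unfold Rdiv. rewrite Rmult_assoc, Rinv_l by lra. lra. }
  assert (H3 : Rabs h ^ m <= (rho / 4) ^ m) by (apply pow_incr; split; [apply Rabs_pos | lra]).
  rewrite !Rabs_mult, <- RPow_abs.
  rewrite (Rabs_pos_eq (_ / _)) by (apply Rlt_le, Rdiv_lt_0_compat; lra).
  apply Rle_trans with (INR (Factorial.fact n) * 2 ^ (m + n) * (A * / rho ^ (m + n)) * (rho / 4) ^ m).
  - apply Rmult_le_compat; [|apply pow_le, Rabs_pos| |exact H3].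
    + apply Rmult_le_pos; [apply Rlt_le, Rdiv_lt_0_compat; lra|apply Rabs_pos].
    + apply Rmult_le_compat; [apply Rlt_le, Rdiv_lt_0_compat; lra|apply Rabs_pos|exact H2|exact H1].
  - right. unfold Rdiv. rewrite !Rpow_mult_distr, !pow_add, !pow_inv.
    replace 4 with (2 * 2) by ring. rewrite Rpow_mult_distr. field.
    repeat split; try (apply pow_nonzero; lra); lra.
Qed.

(** The terms a_n (r/2)^n of a convergent series are bounded, so the preceding estimate applies with
    rho = r/2; near x0 the derivatives of [f] are those of its power series. *)
Lemma real_analytic_local_bound (f : R -> R) (x0 : R) :
  real_analytic f ->
  exists r A K : R, 0 < r /\ 0 < K /\ forall x, Rabs (x - x0) < r -> forall n,
    ex_derive_n f n x /\ Rabs (Derive_n f n x) <= A * INR (Factorial.fact n) * K ^ n.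
Proof.
  intros Hf. destruct (Hf x0) as [r [Hr [a Ha]]].
  assert (Hrho : 0 < r / 2) by lra.
  assert (Hser : ex_series (fun n => a n * (r / 2) ^ n)).
  { exists (f (x0 + r / 2)). apply is_pseries_R.
    replace (r / 2) with (x0 + r / 2 - x0) at 1 by ring.
    apply Ha. replace (x0 + r / 2 - x0) with (r / 2) by ring. rewrite Rabs_pos_eq; lra. }
  apply ex_series_lim_0 in Hser.
  destruct (filterlim_bounded (K := R_AbsRing) (V := R_NormedModule) (fun n => a n * (r / 2) ^ n)) as [A HA].
  { exists 0. exact Hser. }
  assert (Hloc : forall x, Rabs (x - x0) < r ->
    locally x (fun y => PSeries a (y + - x0) = f y)).
  { intros x Hx. assert (Hd : 0 < r - Rabs (x - x0)) by lra.
    exists (mkposreal _ Hd). intros y Hy.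
    change (Rabs (y - x) < r - Rabs (x - x0)) in Hy.
    apply is_pseries_unique. apply Ha.
    replace (y - x0) with ((y - x) + (x - x0)) by ring.
    apply Rle_lt_trans with (1 := Rabs_triang _ _). lra. }
  exists (r / 2 / 4), (2 * A), (2 / (r / 2)).
  split; [lra|]. split; [apply Rdiv_lt_0_compat; lra|].
  intros x Hx n.
  destruct (PS_derive_n_PSeries_bound a A (r / 2) Hrho) with (n := n) (h := x - x0) as [H1 H2].
  { intros k. specialize (HA k). change (Rabs (a k * (r / 2) ^ k) <= A) in HA.
    rewrite Rabs_mult, (Rabs_pos_eq (_ ^ k)) in HA; [exact HA | apply pow_le; lra]. }
  { exact Hx. }
  split.
  - apply ex_derive_n_ext_loc with (1 := Hloc x ltac:(lra)).
    apply (ex_derive_n_comp_trans (PSeries a) n x (- x0)). exact H1.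
  - rewrite <- (Derive_n_ext_loc _ _ n x (Hloc x ltac:(lra))).
    eapply Rle_trans; [right; exact (f_equal Rabs (Derive_n_comp_trans (PSeries a) n x (- x0)))|].
    exact H2.
Qed.

Lemma Z_periodic_reduce (f : R -> R) (x : R) :
  Z_periodic f -> exists y, 0 <= y <= 1 /\ forall n, Derive_n f n x = Derive_n f n y.
Proof.
  intros Hf.
  assert (H1 : forall x n, Derive_n f n (x + 1) = Derive_n f n x).
  { intros z n. rewrite <- Derive_n_comp_trans. apply Derive_n_ext. exact Hf. }
  assert (HN : forall N x n, Derive_n f n (x + INR N) = Derive_n f n x).
  { induction N as [|N IH]; intros z n.
    - simpl. f_equal; ring.
    - rewrite S_INR, <- Rplus_assoc, H1. apply IH. }
  exists (frac_part x). destruct (base_fp x) as [Ha Hb]. split; [lra|].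
  intros n. unfold frac_part. unfold Rminus.
  destruct (Z.le_gt_cases 0 (Int_part x)) as [Hz|Hz].
  - replace x with (x + - IZR (Int_part x) + INR (Z.to_nat (Int_part x))) at 1; [apply HN|].
    rewrite INR_IZR_INZ, Z2Nat.id by lia. ring.
  - rewrite <- opp_IZR.
    rewrite <- (Z2Nat.id (- Int_part x)) by lia. rewrite <- INR_IZR_INZ. symmetry; apply HN.
Qed.

Lemma Bolzano_Weierstrass_01 (s : nat -> R) :
  (forall n, 0 <= s n <= 1) ->
  exists l, forall (eps : R) (N : nat), 0 < eps -> exists n, (N <= n)%nat /\ Rabs (s n - l) < eps.
Proof.
  intros Hs.
  destruct (Bolzano_Weierstrass s _ (compact_P3 0 1) Hs) as [l Hl].
  exists l. intros eps N Heps.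
  apply (Hl (fun y => Rabs (y - l) < eps) N).
  exists (mkposreal eps Heps). intros y Hy. exact Hy.
Qed.

(** Compactness of a period, by contradiction: points violating the bound with constant N + 1
    accumulate at some [l], where the local bound holds with fixed constants. A single [K] serves as
    prefactor and as rate, so that the failures form one sequence. *)
Lemma real_analytic_periodic_bound (f : R -> R) :
  real_analytic f -> Z_periodic f ->
  exists K : R, 0 < K /\ forall x n,
    ex_derive_n f n x /\ Rabs (Derive_n f n x) <= K * INR (Factorial.fact n) * K ^ n.
Proof.
  intros Hf Hp.
  assert (Hex : forall x n, ex_derive_n f n x).
  { intros x n. destruct (real_analytic_local_bound f x Hf) as [r [A [K [Hr [_ H]]]]].
    apply H. unfold Rminus; rewrite Rplus_opp_r, Rabs_R0; exact Hr. }
  assert (HN : exists N : nat, forall x n, 0 <= x <= 1 ->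
     Rabs (Derive_n f n x) <= INR (S N) * INR (Factorial.fact n) * INR (S N) ^ n).
  { apply NNPP. intros Hneg.
    assert (Hs : forall N : nat, exists x, 0 <= x <= 1 /\ exists n,
       INR (S N) * INR (Factorial.fact n) * INR (S N) ^ n < Rabs (Derive_n f n x)).
    { intros N. apply NNPP. intros HN. apply Hneg. exists N. intros x n Hx.
      apply Rnot_lt_le. intros Hlt. apply HN. exists x. split; [exact Hx|]. exists n. exact Hlt. }
    apply functional_choice in Hs. destruct Hs as [s Hs].
    destruct (Bolzano_Weierstrass_01 s) as [l Hl]; [intros n; apply Hs|].
    destruct (real_analytic_local_bound f l Hf) as [r [A [K [Hr [HK H]]]]].
    destruct (INR_unbounded (Rmax A K)) as [N0 HN0].
    assert (HA := Rmax_l A K). assert (HK' := Rmax_r A K).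
    destruct (Hl r N0 Hr) as [N [HNN HN]].
    destruct (Hs N) as [_ [n Hn]]. destruct (H (s N) HN n) as [_ H'].
    apply le_INR in HNN. 
    apply (Rlt_irrefl (Rabs (Derive_n f n (s N)))). eapply Rle_lt_trans; [exact H'|].
    eapply Rle_lt_trans; [|exact Hn]. rewrite !S_INR.
    assert (Hfn := INR_fact_lt_0 n).
    assert (Hpw : K ^ n <= (INR N + 1) ^ n) by (apply pow_incr; lra).
    assert (0 <= K ^ n) by (apply pow_le; lra).
    apply Rle_trans with ((INR N + 1) * INR (Factorial.fact n) * K ^ n).
    - apply Rmult_le_compat_r; [assumption|]. apply Rmult_le_compat_r; lra.
    - apply Rmult_le_compat_l; [|exact Hpw]. apply Rmult_le_pos; lra. }
  destruct HN as [N HN].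
  exists (INR (S N)). split; [apply lt_0_INR; lia|].
  intros x n. split; [apply Hex|].
  destruct (Z_periodic_reduce f x Hp) as [y [Hy Hxy]]. rewrite Hxy. apply HN; exact Hy.
Qed.

(** * Functions with uniform Taylor expansions and the identity theorem *)

(* Uniform quantitative analyticity, phrased so that no series of functions has
   to be differentiated: [a x k] plays the role of [f^(k)(x) / k!]. *)
Definition has_expansion (M K : R) (f : R -> R) (a : R -> nat -> R) : Prop :=
  (forall x k, Rabs (a x k) <= M * K ^ k) /\
  (forall x h Q, Rabs (f (x + h) - sum_f_R0 (fun k => a x k * h ^ k) Q)
                 <= M * (K * Rabs h) ^ S Q).

Lemma sum_f_R0_at_0 (a : nat -> R) (Q : nat) :
  sum_f_R0 (fun k => a k * 0 ^ k) Q = a 0%nat.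
Proof.
  induction Q as [|Q IH]; simpl; [ring|]. rewrite IH. ring.
Qed.

Lemma Taylor_bound_right (f : R -> R) (A K x h : R) (Q : nat) :
  (forall x n, ex_derive_n f n x /\ Rabs (Derive_n f n x) <= A * INR (Factorial.fact n) * K ^ n) ->
  0 < h ->
  Rabs (f (x + h) - sum_f_R0 (fun k => Derive_n f k x / INR (Factorial.fact k) * h ^ k) Q)
    <= A * (K * h) ^ S Q.
Proof.
  intros Hf Hh.
  destruct (Taylor_Lagrange f Q x (x + h)) as [z [_ Hz]]; [lra|intros; apply Hf|].
  rewrite Hz. replace (x + h - x) with h by ring.
  rewrite (sum_eq _ (fun k => Derive_n f k x / INR (Factorial.fact k) * h ^ k))
    by (intros i _; unfold Rdiv; ring).
  unfold Rminus. rewrite Rplus_comm, <- Rplus_assoc, Rplus_opp_l, Rplus_0_l.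
  destruct (Hf z (S Q)) as [_ Hd].
  assert (Hfp := INR_fact_lt_0 (S Q)). assert (Hhp : 0 < h ^ S Q) by (apply pow_lt; lra).
  rewrite Rabs_mult, Rabs_pos_eq by (apply Rlt_le, Rdiv_lt_0_compat; lra).
  eapply Rle_trans; [apply Rmult_le_compat_l; [apply Rlt_le, Rdiv_lt_0_compat; lra|exact Hd]|].
  right. rewrite Rpow_mult_distr. field. lra.
Qed.

Lemma Taylor_has_expansion (f : R -> R) (A K : R) :
  (forall x n, ex_derive_n f n x /\ Rabs (Derive_n f n x) <= A * INR (Factorial.fact n) * K ^ n) ->
  has_expansion A K f (fun x k => Derive_n f k x / INR (Factorial.fact k)).
Proof.
  intros Hf.
  assert (Hc : forall x k, Rabs (Derive_n f k x / INR (Factorial.fact k)) <= A * K ^ k).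
  { intros x k. assert (Hk := INR_fact_lt_0 k). destruct (Hf x k) as [_ H].
    unfold Rdiv. rewrite Rabs_mult, Rabs_inv, (Rabs_pos_eq (INR _)) by lra.
    apply (Rmult_le_reg_r (INR (Factorial.fact k))); [exact Hk|].
    rewrite Rmult_assoc, Rinv_l by lra. lra. }
  split; [exact Hc|].
  intros x h Q. destruct (Rtotal_order h 0) as [Hh|[->|Hh]].
  (* A negative increment is handled by reflecting [f]; the signs (-1)^k from the derivatives are
     absorbed by (-h)^k. *)
  - assert (Hder : forall n y, Derive_n (fun z => f (- z)) n y = (-1) ^ n * Derive_n f n (- y)).
    { intros n y. apply Derive_n_comp_opp. apply filter_forall. intros; apply Hf. }
    assert (Hg : forall y n, ex_derive_n (fun z => f (- z)) n y /\
       Rabs (Derive_n (fun z => f (- z)) n y) <= A * INR (Factorial.fact n) * K ^ n).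
    { intros y n. split.
      - apply ex_derive_n_comp_opp. apply filter_forall. intros; apply Hf.
      - rewrite Hder, Rabs_mult, pow_1_abs, Rmult_1_l. apply Hf. }
    assert (H := Taylor_bound_right _ A K (- x) (- h) Q Hg ltac:(lra)).
    simpl in H. replace (- (- x + - h)) with (x + h) in H by ring.
    rewrite (Rabs_left h) by lra.
    erewrite sum_eq; [exact H|]. intros i _. cbv beta. rewrite Hder, Ropp_involutive.
    replace (h ^ i) with ((-1) ^ i * (- h) ^ i); [unfold Rdiv; ring|].
    rewrite <- Rpow_mult_distr. f_equal; ring.
  - rewrite sum_f_R0_at_0, Rabs_R0, Rmult_0_r, Rplus_0_r. simpl.
    rewrite Rdiv_1_r, Rminus_diag, Rabs_R0. right; ring.
  - rewrite (Rabs_pos_eq h) by lra. apply Taylor_bound_right; assumption.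
Qed.

Lemma Derive_has_expansion (f : R -> R) :
  real_analytic f -> Z_periodic f ->
  exists M K a, 0 < M /\ 0 < K /\ has_expansion M K (Derive f) a.
Proof.
  intros Ha Hp. destruct (real_analytic_periodic_bound f Ha Hp) as [K [HK H]].
  assert (HD : forall n x, Derive_n (Derive f) n x = Derive_n f (S n) x).
  { intros n x. rewrite <- Nat.add_1_r, <- Derive_n_comp. reflexivity. }
  (* The derivative of order n + 1 brings (n+1)! = (n+1) n!. The factor n + 1 <= 2^n goes into the
     doubled rate, and the extra power of [K] into the prefactor. *)
  exists (K * K), (2 * K), (fun x k => Derive_n (Derive f) k x / INR (Factorial.fact k)).
  split; [nra|]. split; [lra|].
  apply Taylor_has_expansion. intros x n. split.
  - destruct n as [|n]; [exact I|].
    apply (ex_derive_ext (Derive_n f (S n))); [intros t; symmetry; apply HD|].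
    exact (proj1 (H x (S (S n)))).
  - rewrite HD. eapply Rle_trans; [apply H|].
    rewrite fact_simpl, mult_INR, Rpow_mult_distr. simpl (K ^ S n).
    assert (Hn : INR (S n) <= 2 ^ n).
    { clear. induction n as [|n IH]; [simpl; lra|]. rewrite S_INR. change (2 ^ S n) with (2 * 2 ^ n).
      assert (1 <= 2 ^ n) by (apply pow_R1_Rle; lra). lra. }
    assert (0 < INR (Factorial.fact n)) by apply INR_fact_lt_0.
    assert (0 < K ^ n) by (apply pow_lt; lra).
    replace (K * (INR (S n) * INR (Factorial.fact n)) * (K * K ^ n))
      with (INR (S n) * (K * K * INR (Factorial.fact n) * K ^ n)) by ring.
    replace (K * K * INR (Factorial.fact n) * (2 ^ n * K ^ n))
      with (2 ^ n * (K * K * INR (Factorial.fact n) * K ^ n)) by ring.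
    apply Rmult_le_compat_r; [|exact Hn].
    repeat apply Rmult_le_pos; lra.
Qed.

Lemma has_expansion_coef_0 M K f a : has_expansion M K f a -> forall x, a x 0%nat = f x.
Proof.
  intros [_ H] x. specialize (H x 0 0%nat). simpl in H.
  rewrite Rabs_R0, Rplus_0_r, !Rmult_1_r, !Rmult_0_r in H.
  apply Rabs_le_between in H. lra.
Qed.

Lemma has_expansion_bounded M K f a : has_expansion M K f a -> forall x, Rabs (f x) <= M.
Proof.
  intros H x. rewrite <- (has_expansion_coef_0 _ _ _ _ H x).
  eapply Rle_trans; [apply H|]. simpl. lra.
Qed.

Lemma has_expansion_lipschitz M K f a :
  has_expansion M K f a -> forall x y, Rabs (f x - f y) <= M * K * Rabs (x - y).
Proof.
  intros H x y. assert (H0 := has_expansion_coef_0 _ _ _ _ H y).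
  destruct H as [_ H]. specialize (H y (x - y) 0%nat). simpl in H.
  rewrite !Rmult_1_r, H0 in H. replace (y + (x - y)) with x in H by ring. lra.
Qed.

Lemma has_expansion_minus M K f a g c :
  has_expansion M K f a -> has_expansion M K g c ->
  has_expansion (2 * M) K (fun x => f x - g x) (fun x k => a x k - c x k).
Proof.
  intros [Ha Hf] [Hc Hg]. split.
  - intros x k. specialize (Ha x k). specialize (Hc x k).
    apply Rabs_le_between in Ha. apply Rabs_le_between in Hc. apply Rabs_le_between. lra.
  - intros x h Q. specialize (Hf x h Q). specialize (Hg x h Q).
    rewrite (sum_eq _ (fun k => a x k * h ^ k - c x k * h ^ k)) by (intros; ring).
    rewrite minus_sum.
    apply Rabs_le_between in Hf. apply Rabs_le_between in Hg. apply Rabs_le_between. lra.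
Qed.

(** Only the remainder survives; it is at most M 2^-(N+1) since K|h| <= 1/2, and the order N is
    arbitrary. *)
Lemma has_expansion_vanish M K f a x :
  0 < K -> has_expansion M K f a -> (forall k, a x k = 0) ->
  forall h, Rabs h <= / (2 * K) -> f (x + h) = 0.
Proof.
  intros HK H Hx h Hh.
  assert (HM : 0 <= M) by (eapply Rle_trans; [apply Rabs_pos|apply (has_expansion_bounded _ _ _ _ H x)]).
  apply NNPP. intros Hne. apply Rabs_pos_lt in Hne.
  destruct (pow_lt_1_zero (/ 2)) with (y := Rabs (f (x + h)) / (M + 1)) as [N HN].
  { rewrite Rabs_pos_eq; lra. }
  { apply Rdiv_lt_0_compat; lra. }
  specialize (HN (S N) ltac:(lia)). rewrite Rabs_pos_eq in HN by (apply pow_le; lra).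
  destruct H as [_ H]. specialize (H x h N).
  rewrite (sum_eq _ (fun k => 0 * h ^ k)) in H by (intros; rewrite Hx; ring).
  rewrite (sum_eq _ (fun k => 0)) in H by (intros; ring).
  rewrite sum_cte, Rmult_0_l, Rminus_0_r in H.
  assert (Hpw : (K * Rabs h) ^ S N <= (/ 2) ^ S N).
  { apply pow_incr. split; [apply Rmult_le_pos; [lra|apply Rabs_pos]|].
    apply Rle_trans with (K * / (2 * K)); [apply Rmult_le_compat_l; lra|]. right; field; lra. }
  apply (Rmult_lt_compat_l (M + 1)) in HN; [|lra].
  replace ((M + 1) * (Rabs (f (x + h)) / (M + 1))) with (Rabs (f (x + h))) in HN by (field; lra).
  assert (0 < (/ 2) ^ S N) by (apply pow_lt; lra).
  nra.
Qed.

(** Where [f] vanishes, its Taylor polynomial of degree k is as small as the remainder. Rescaled to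
    length d, this gives |a_k| d^k <= C M (K d)^(k+1), hence |a_k| <= D d, which fails for small d
    unless a_k = 0. *)
Lemma has_expansion_coef_vanish M K f a x s :
  0 < K -> 0 < s -> has_expansion M K f a -> (forall y, Rabs (y - x) < s -> f y = 0) ->
  forall k, a x k = 0.
Proof.
  intros HK Hs H Hx k.
  assert (HM : 0 <= M) by (eapply Rle_trans; [apply Rabs_pos|apply (has_expansion_bounded _ _ _ _ H x)]).
  destruct (poly_coef_bound k) as [C [HC HP]].
  apply NNPP. intros Hne. apply Rabs_pos_lt in Hne.
  set (D := C * M * K ^ S k).
  assert (HD : 0 <= D).
  { unfold D. apply Rmult_le_pos; [apply Rmult_le_pos; lra|apply pow_le; lra]. }
  (* The first entry keeps the interval inside the zero set, the second makes D d smaller than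
     |a_k|. *)
  set (d := Rmin (s / 2) (Rabs (a x k) / (2 * (D + 1)))).
  assert (Hd : 0 < d) by (apply Rmin_pos; [lra|apply Rdiv_lt_0_compat; lra]).
  assert (Hd1 : d <= s / 2) by apply Rmin_l.
  assert (Hd2 : d <= Rabs (a x k) / (2 * (D + 1))) by apply Rmin_r.
  assert (HB : Rabs (a x k * d ^ k) <= C * (M * (K * d) ^ S k)).
  { apply (HP (fun j => a x j * d ^ j)); [|lia]. intros t Ht.
    destruct H as [_ H]. specialize (H x (d * t) k).
    rewrite (Hx (x + d * t)) in H.
    2:{ replace (x + d * t - x) with (d * t) by ring. rewrite Rabs_pos_eq; nra. }
    rewrite Rminus_0_l, Rabs_Ropp in H.
    rewrite (sum_eq _ (fun j => a x j * (d * t) ^ j)) by (intros; rewrite Rpow_mult_distr; ring).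
    eapply Rle_trans; [exact H|]. apply Rmult_le_compat_l; [exact HM|].
    rewrite (Rabs_pos_eq (d * t)) by nra.
    apply pow_incr; split; [repeat apply Rmult_le_pos; lra|].
    apply Rmult_le_compat_l; [lra|]. nra. }
  rewrite Rabs_mult, (Rabs_pos_eq (d ^ k)) in HB by (apply pow_le; lra).
  assert (Hdk : 0 < d ^ k) by (apply pow_lt; lra).
  assert (H1 : Rabs (a x k) <= D * d).
  { apply (Rmult_le_reg_r (d ^ k)); [exact Hdk|]. eapply Rle_trans; [exact HB|].
    right. unfold D. rewrite Rpow_mult_distr. simpl. ring. }
  assert (H2 : (D + 1) * d <= Rabs (a x k) / 2).
  { apply Rle_trans with ((D + 1) * (Rabs (a x k) / (2 * (D + 1)))).
    - apply Rmult_le_compat_l; lra.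
    - right; field; lra. }
  nra.
Qed.

(** Identity theorem. Vanishing of all coefficients propagates from a point to its whole
    s/2-neighbourhood, with [s] independent of the point, so finitely many steps reach any x. *)
Lemma has_expansion_identity M K f a x0 :
  0 < K -> has_expansion M K f a -> (forall k, a x0 k = 0) -> forall x, f x = 0.
Proof.
  intros HK H H0.
  set (s := / (2 * K)). assert (Hs : 0 < s) by (apply Rinv_0_lt_compat; lra).
  assert (Hstep : forall y x, (forall k, a y k = 0) -> Rabs (x - y) <= s / 2 -> forall k, a x k = 0).
  { intros y x Hy Hxy. apply (has_expansion_coef_vanish M K f a x (s / 2) HK); [lra|exact H|].
    intros z Hz. replace z with (y + (z - y)) by ring.
    apply (has_expansion_vanish M K f a y HK H Hy).
    replace (z - y) with ((z - x) + (x - y)) by ring.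
    eapply Rle_trans; [apply Rabs_triang|]. fold s. lra. }
  assert (HN : forall N x, Rabs (x - x0) <= INR N * (s / 2) -> forall k, a x k = 0).
  { induction N as [|N IH]; intros x Hx.
    - simpl in Hx. rewrite Rmult_0_l in Hx. apply Rabs_le_between in Hx.
      replace x with x0 by lra. exact H0.
    - assert (HS : 0 < INR (S N)) by (apply lt_0_INR; lia).
      assert (HI : 0 <= INR N) by apply pos_INR.
      rewrite S_INR in HS.
      (* The previous point of the chain divides the segment from x0 to x in the ratio N : 1, so it
         is within N steps of x0 and one step of x. *)
      apply (Hstep (x0 + INR N / INR (S N) * (x - x0))).
      + apply IH.
        replace (x0 + INR N / INR (S N) * (x - x0) - x0) with (INR N * ((x - x0) / INR (S N)))
          by (rewrite S_INR; field; lra).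
        rewrite Rabs_mult, Rabs_pos_eq by exact HI. apply Rmult_le_compat_l; [exact HI|].
        unfold Rdiv. rewrite Rabs_mult, Rabs_inv, (Rabs_pos_eq (INR (S N))) by apply pos_INR.
        apply (Rmult_le_reg_r (INR (S N))); [rewrite S_INR; lra|].
        rewrite Rmult_assoc, Rinv_l by (rewrite S_INR; lra). lra.
      + replace (x - (x0 + INR N / INR (S N) * (x - x0))) with ((x - x0) / INR (S N))
          by (rewrite S_INR; field; lra).
        unfold Rdiv. rewrite Rabs_mult, Rabs_inv, (Rabs_pos_eq (INR (S N))) by apply pos_INR.
        apply (Rmult_le_reg_r (INR (S N))); [rewrite S_INR; lra|].
        rewrite Rmult_assoc, Rinv_l by (rewrite S_INR; lra). lra. }
  intros x. rewrite <- (has_expansion_coef_0 _ _ _ _ H x).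
  destruct (INR_unbounded (Rabs (x - x0) / (s / 2))) as [N HN'].
  apply (HN N).
  apply (Rmult_lt_compat_r (s / 2)) in HN'; [|lra].
  unfold Rdiv in HN' at 1. rewrite Rmult_assoc, Rinv_l in HN' by lra. lra.
Qed.

(** * Taylor expansions of Y(., w), uniform in w *)

Lemma Series_sum_f_R0 (g : nat -> nat -> R) (Q : nat) :
  (forall k, (k <= Q)%nat -> ex_series (g k)) ->
  ex_series (fun m => sum_f_R0 (fun k => g k m) Q) /\
  sum_f_R0 (fun k => Series (g k)) Q = Series (fun m => sum_f_R0 (fun k => g k m) Q).
Proof.
  induction Q as [|Q IH]; intros H.
  - simpl. split; [apply H; lia | reflexivity].
  - destruct IH as [H1 H2]; [intros; apply H; lia|]. simpl. split.
    + apply (@ex_series_plus R_AbsRing R_NormedModule); [exact H1|apply H; lia].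
    + rewrite Series_plus; [rewrite H2; reflexivity|exact H1|apply H; lia].
Qed.

(** The k-th Taylor coefficient of Y(., w) at x, found summand by summand: x enters [Yarg] with
    slope b^-(m+1), which contributes the k-th power of that slope. *)
Definition Ycoef (b : nat) (g : R) (a : R -> nat -> R) (w : nat -> nat) (x : R) (k : nat) : R :=
  - Series (fun m => g ^ S m * (a (Yarg b x w (S m)) k * (/ INR b ^ S m) ^ k)).

(** The slopes b^-(m+1) are at most 1, so every summand keeps the bounds of phi', and the weights
    gamma^(m+1) <= gamma^m sum to at most 1/(1 - gamma). The letters of [w] only move the base
    points, so the constants do not depend on them. *)
Lemma Y_has_expansion (b : nat) (lambda : R) (phi : R -> R) (M K : R) (a : R -> nat -> R)
    (w : nat -> nat) :
  (2 <= b)%nat -> 0 < / (INR b * lambda) < 1 -> 0 < K ->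
  has_expansion M K (Derive phi) a ->
  has_expansion (M / (1 - / (INR b * lambda))) K
    (fun x => Y b lambda phi x w) (Ycoef b (/ (INR b * lambda)) a w).
Proof.
  intros Hb. set (g := / (INR b * lambda)). intros Hg HK H.
  assert (HM : 0 <= M) by (eapply Rle_trans; [apply Rabs_pos|apply (has_expansion_bounded _ _ _ _ H 0)]).
  assert (Hpsi := has_expansion_bounded _ _ _ _ H).
  destruct H as [Hc He].
  assert (Hb1 : 1 <= INR b) by (apply (le_INR 1); lia).
  assert (Hbp : forall m, 0 < / INR b ^ m <= 1).
  { intros m. assert (1 <= INR b ^ m) by (apply pow_R1_Rle; exact Hb1). split.
    - apply Rinv_0_lt_compat; lra.
    - rewrite <- Rinv_1. apply Rinv_le_contravar; lra. }
  assert (Hgp : forall m, 0 < g ^ S m <= g ^ m).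
  { intros m. assert (0 < g ^ m) by (apply pow_lt; lra). simpl. nra. }
  assert (Hdom : forall m r B, Rabs r <= B -> Rabs (g ^ S m * r) <= B * g ^ m).
  { intros m r B Hr. rewrite Rabs_mult, Rabs_pos_eq by (apply Rlt_le, Hgp).
    rewrite Rmult_comm. apply Rmult_le_compat; [apply Rabs_pos|apply Rlt_le, Hgp|exact Hr|apply Hgp]. }
  assert (Hcm : forall x k m, Rabs (g ^ S m * (a (Yarg b x w (S m)) k * (/ INR b ^ S m) ^ k))
      <= M * K ^ k * g ^ m).
  { intros x k m. apply Hdom. rewrite Rabs_mult, (Rabs_pos_eq (_ ^ k)) by (apply pow_le, Rlt_le, Hbp).
    assert (H1 : (/ INR b ^ S m) ^ k <= 1).
    { rewrite <- (pow1 k). apply pow_incr. split; [apply Rlt_le, Hbp|apply Hbp]. }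
    assert (H2 : 0 <= (/ INR b ^ S m) ^ k) by (apply pow_le, Rlt_le, Hbp).
    assert (H3 := Hc (Yarg b x w (S m)) k). assert (H4 := Rabs_pos (a (Yarg b x w (S m)) k)). nra. }
  split.
  - intros x k. unfold Ycoef. rewrite Rabs_Ropp.
    replace (M / (1 - g) * K ^ k) with (M * K ^ k / (1 - g)) by (unfold Rdiv; ring).
    apply Series_geom_dominated; [lra|]. apply Hcm.
  - intros x h Q. unfold Ycoef, Y. fold g.
    rewrite (sum_eq _ (fun k => - Series (fun m => h ^ k * (g ^ S m * (a (Yarg b x w (S m)) k * (/ INR b ^ S m) ^ k))))).
    2:{ intros i _. rewrite Series_scal_l. ring. }
    assert (Hs : forall F Q, sum_f_R0 (fun k => - F k) Q = - sum_f_R0 F Q).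
    { intros F Q'. induction Q' as [|Q' IH]; simpl; [reflexivity|]. rewrite IH. ring. }
    rewrite Hs.
    destruct (Series_sum_f_R0 (fun k m => h ^ k * (g ^ S m * (a (Yarg b x w (S m)) k * (/ INR b ^ S m) ^ k))) Q) as [He1 Hsw].
    { intros k _. apply (@ex_series_scal_l R_AbsRing).
      apply (ex_series_geom_dominated _ (M * K ^ k) g); [lra|]. apply Hcm. }
    rewrite Hsw.
    assert (He2 : ex_series (fun m => g ^ S m * Derive phi (Yarg b (x + h) w (S m)))).
    { apply (ex_series_geom_dominated _ M g); [lra|]. intros m. apply Hdom, Hpsi. }
    replace (- Series (fun m => g ^ S m * Derive phi (Yarg b (x + h) w (S m))) - - Series (fun m => sum_f_R0 (fun k => h ^ k * (g ^ S m * (a (Yarg b x w (S m)) k * (/ INR b ^ S m) ^ k))) Q))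
     with (- (Series (fun m => g ^ S m * Derive phi (Yarg b (x + h) w (S m))) - Series (fun m => sum_f_R0 (fun k => h ^ k * (g ^ S m * (a (Yarg b x w (S m)) k * (/ INR b ^ S m) ^ k))) Q))) by ring.
    rewrite Rabs_Ropp, <- Series_minus by assumption.
    replace (M / (1 - g) * (K * Rabs h) ^ S Q) with (M * (K * Rabs h) ^ S Q / (1 - g)) by (unfold Rdiv; ring).
    apply Series_geom_dominated; [lra|]. intros m.
    replace (g ^ S m * Derive phi (Yarg b (x + h) w (S m)) -
      sum_f_R0 (fun k => h ^ k * (g ^ S m * (a (Yarg b x w (S m)) k * (/ INR b ^ S m) ^ k))) Q)
     with (g ^ S m * (Derive phi (Yarg b x w (S m) + h * / INR b ^ S m) -
       sum_f_R0 (fun k => a (Yarg b x w (S m)) k * (h * / INR b ^ S m) ^ k) Q)).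
    2:{ rewrite Rmult_minus_distr_l, scal_sum. f_equal.
        - f_equal. f_equal. unfold Yarg, Rdiv. ring.
        - apply sum_eq. intros i _. rewrite Rpow_mult_distr. ring. }
    apply Hdom. eapply Rle_trans; [apply He|]. apply Rmult_le_compat_l; [exact HM|].
    apply pow_incr. split; [apply Rmult_le_pos; [lra|apply Rabs_pos]|].
    apply Rmult_le_compat_l; [lra|].
    rewrite Rabs_mult, (Rabs_pos_eq (/ _)) by (apply Rlt_le, Hbp).
    assert (H1 := Hbp (S m)). assert (H2 := Rabs_pos h). nra.
Qed.

(** * Dependence of Y on the letters: prefixes, shift, renormalization *)

Lemma Series_geom_tail (m : nat) (d : nat -> R) (G q : R) :
  0 <= q < 1 -> (forall j, Rabs (d j) <= G * q ^ j) -> (forall j, (j < m)%nat -> d j = 0) ->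
  Rabs (Series d) <= G * q ^ m / (1 - q).
Proof.
  intros Hq. revert d G. induction m as [|m IH]; intros d G Hd Hz.
  - rewrite Rmult_1_r. apply Series_geom_dominated; assumption.
  - rewrite Series_incr_1 by (apply (ex_series_geom_dominated d G q); assumption).
    rewrite Hz, Rplus_0_l by lia.
    replace (G * q ^ S m) with (G * q * q ^ m) by (simpl; ring).
    apply IH.
    + intros j. eapply Rle_trans; [apply Hd|]. right; simpl; ring.
    + intros j Hj. apply Hz. lia.
Qed.

Lemma Yarg_prefix b x u v n :
  (forall k, (k <= n)%nat -> u k = v k) -> Yarg b x u n = Yarg b x v n.
Proof.
  intros H. unfold Yarg. f_equal. apply sum_n_m_ext_loc. intros k Hk. rewrite H by lia. reflexivity.
Qed.

(** The first m summands involve only the letters up to m and cancel, leaving a geometric tail. This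
    is continuity of Y in the sequence, uniformly in x. *)
Lemma Y_prefix_close (b : nat) (lambda : R) (phi : R -> R) (M x : R) (u v : nat -> nat) (m : nat) :
  0 < / (INR b * lambda) < 1 -> (forall y, Rabs (Derive phi y) <= M) ->
  (forall k, (k <= m)%nat -> u k = v k) ->
  Rabs (Y b lambda phi x u - Y b lambda phi x v)
    <= 2 * M / (1 - / (INR b * lambda)) * (/ (INR b * lambda)) ^ m.
Proof.
  set (g := / (INR b * lambda)). intros Hg HM Huv. unfold Y. fold g.
  assert (Hgp : forall j, 0 < g ^ S j <= g ^ j).
  { intros j. assert (0 < g ^ j) by (apply pow_lt; lra). simpl. nra. }
  assert (Hex : forall w, ex_series (fun m => g ^ S m * Derive phi (Yarg b x w (S m)))).
  { intros w. apply (ex_series_geom_dominated _ M g); [lra|]. intros j.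
    rewrite Rabs_mult, Rabs_pos_eq by (apply Rlt_le, Hgp). rewrite Rmult_comm.
    apply Rmult_le_compat; [apply Rabs_pos|apply Rlt_le, Hgp|apply HM|apply Hgp]. }
  replace (- Series (fun m => g ^ S m * Derive phi (Yarg b x u (S m))) -
    - Series (fun m => g ^ S m * Derive phi (Yarg b x v (S m))))
   with (Series (fun m => g ^ S m * Derive phi (Yarg b x v (S m))) -
    Series (fun m => g ^ S m * Derive phi (Yarg b x u (S m)))) by ring.
  rewrite <- Series_minus by apply Hex.
  replace (2 * M / (1 - g) * g ^ m) with (2 * M * g ^ m / (1 - g)) by (unfold Rdiv; ring).
  apply Series_geom_tail; [lra| |].
  - intros j. rewrite <- Rmult_minus_distr_l, Rabs_mult, Rabs_pos_eq by (apply Rlt_le, Hgp).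
    rewrite Rmult_comm.
    apply Rmult_le_compat; [apply Rabs_pos|apply Rlt_le, Hgp| |apply Hgp].
    assert (H1 := HM (Yarg b x v (S j))). assert (H2 := HM (Yarg b x u (S j))).
    apply Rabs_le_between in H1. apply Rabs_le_between in H2. apply Rabs_le_between. lra.
  - intros j Hj. rewrite (Yarg_prefix b x u v (S j)) by (intros; apply Huv; lia). ring.
Qed.

Definition shift_seq (u : nat -> nat) (k : nat) : nat :=
  match k with 0%nat => 0%nat | S _ => u (S k) end.

Lemma shift_seq_inSigma b u : inSigma b u -> inSigma b (shift_seq u).
Proof.
  intros [H0 H]. split; [reflexivity|]. intros [|k]; simpl; [rewrite <- H0|]; apply H.
Qed.

(** The first letter has the same weight b^-(m+2) as x, so it can be absorbed into the base
    point. *)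
Lemma Yarg_shift b x u m :
  (2 <= b)%nat ->
  Yarg b x u (S (S m)) = Yarg b ((x + INR (u 1%nat)) / INR b) (shift_seq u) (S m).
Proof.
  intros Hb. assert (HB : INR b <> 0) by (apply not_0_INR; lia).
  assert (Hp : forall k, INR b ^ k <> 0) by (intros; apply pow_nonzero; exact HB).
  unfold Yarg. rewrite sum_Sn_m by lia.
  rewrite <- sum_n_m_S.
  rewrite (sum_n_m_ext_loc _ (fun k => INR (shift_seq u k) / INR b ^ (S m + 1 - k))).
  2:{ intros k Hk. destruct k as [|k]; [lia|]. simpl shift_seq.
      replace (S (S m) + 1 - S (S k))%nat with (S m + 1 - S k)%nat by lia. reflexivity. }
  change plus with Rplus.
  match goal with |- context [sum_n_m ?F 1 (S m)] => set (T := sum_n_m F 1 (S m)) end.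
  replace (S (S m) + 1 - 1)%nat with (S (S m)) by lia.
  change (x / INR b ^ S (S m) + (INR (u 1%nat) / INR b ^ S (S m) + T)
    = (x + INR (u 1%nat)) / INR b / INR b ^ S m + T).
  change (INR b ^ S (S m)) with (INR b * INR b ^ S m).
  field. split; first [exact HB | apply Hp].
Qed.

Lemma Yarg_1 b x u : Yarg b x u 1 = (x + INR (u 1%nat)) / INR b.
Proof.
  unfold Yarg. rewrite sum_n_n. simpl. rewrite !Rmult_1_r. unfold Rdiv. ring.
Qed.

(** Splitting off the first summand gives a functional equation whose phi' term sees only u_1; it
    therefore cancels between sequences with the same first letter. *)
Lemma Y_shift (b : nat) (lambda : R) (phi : R -> R) (M x : R) (u : nat -> nat) :
  (2 <= b)%nat -> 0 < / (INR b * lambda) < 1 -> (forall y, Rabs (Derive phi y) <= M) ->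
  Y b lambda phi x u = / (INR b * lambda) *
    (Y b lambda phi ((x + INR (u 1%nat)) / INR b) (shift_seq u)
     - Derive phi ((x + INR (u 1%nat)) / INR b)).
Proof.
  set (g := / (INR b * lambda)). intros Hb Hg HM. unfold Y. fold g.
  rewrite Series_incr_1.
  2:{ apply (ex_series_geom_dominated _ M g); [lra|]. intros j.
      assert (0 < g ^ j) by (apply pow_lt; lra).
      assert (0 < g ^ S j <= g ^ j) by (simpl; nra).
      rewrite Rabs_mult, Rabs_pos_eq by lra. rewrite Rmult_comm.
      apply Rmult_le_compat; [apply Rabs_pos|lra|apply HM|lra]. }
  rewrite Yarg_1.
  rewrite (Series_ext (fun k => g ^ S (S k) * Derive phi (Yarg b x u (S (S k))))
    (fun k => g * (g ^ S k * Derive phi (Yarg b ((x + INR (u 1%nat)) / INR b) (shift_seq u) (S k))))).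
  2:{ intros k. rewrite Yarg_shift by exact Hb. simpl; ring. }
  rewrite Series_scal_l. simpl (g ^ 1). ring.
Qed.

(** Each common letter is removed by [Y_shift], at the price of one factor gamma and one contraction
    x -> (x + u_1)/b. The interval from q to q + b^-n is the image of [0,1] under the composed
    contractions. *)
Lemma Y_renormalize (b : nat) (lambda : R) (phi : R -> R) (M : R) (n : nat) :
  (2 <= b)%nat -> 0 < / (INR b * lambda) < 1 -> (forall y, Rabs (Derive phi y) <= M) ->
  forall u v, inSigma b u -> inSigma b v ->
  (forall k, (k <= n)%nat -> u k = v k) -> u (S n) <> v (S n) ->
  exists u' v' q, inSigma b u' /\ inSigma b v' /\ u' 1%nat <> v' 1%nat /\
    0 <= q /\ q + / INR b ^ n <= 1 /\
    forall x, Y b lambda phi x u - Y b lambda phi x v =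
      (/ (INR b * lambda)) ^ n *
      (Y b lambda phi (q + / INR b ^ n * x) u' - Y b lambda phi (q + / INR b ^ n * x) v').
Proof.
  set (g := / (INR b * lambda)). intros Hb Hg HM.
  assert (HB : 2 <= INR b) by (apply (le_INR 2); lia).
  induction n as [|n IH]; intros u v Hu Hv Heq Hne.
  - exists u, v, 0. repeat split; try assumption; try apply Hu; try apply Hv; try lra.
    + simpl. lra.
    + intros x. simpl. rewrite Rinv_1, Rplus_0_l, !Rmult_1_l. reflexivity.
  - destruct (IH (shift_seq u) (shift_seq v)) as (u' & v' & q & Hu' & Hv' & H1 & Hq0 & Hq1 & HY).
    + apply shift_seq_inSigma; exact Hu.
    + apply shift_seq_inSigma; exact Hv.
    + intros [|k] Hk; simpl; [reflexivity|]. apply Heq; lia.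
    + exact Hne.
    + assert (Hpn : 0 < / INR b ^ n) by (apply Rinv_0_lt_compat, pow_lt; lra).
      assert (Hinv : 0 < / INR b) by (apply Rinv_0_lt_compat; lra).
      assert (Hub : INR (u 1%nat) + 1 <= INR b).
      { rewrite <- S_INR. apply le_INR. apply Hu. }
      assert (Hu0 := pos_INR (u 1%nat)).
      (* The new base point is the image of u_1/b under the affine map obtained for the shifted
         sequences. *)
      exists u', v', (q + / INR b ^ n * (INR (u 1%nat) / INR b)).
      repeat split; try apply Hu'; try apply Hv'; try assumption.
      * assert (0 <= INR (u 1%nat) / INR b) by (unfold Rdiv; nra). nra.
      * apply Rle_trans with (2 := Hq1). simpl. rewrite Rinv_mult.
        assert ((INR (u 1%nat) + 1) * / INR b <= 1).
        { apply (Rmult_le_reg_r (INR b)); [lra|]. rewrite Rmult_assoc, Rinv_l; lra. }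
        unfold Rdiv. nra.
      * intros x. rewrite (Y_shift b lambda phi M x u), (Y_shift b lambda phi M x v) by assumption. fold g.
        rewrite <- (Heq 1%nat) by lia.
        rewrite <- Rmult_minus_distr_l.
        replace (Y b lambda phi ((x + INR (u 1%nat)) / INR b) (shift_seq u) - Derive phi ((x + INR (u 1%nat)) / INR b) -
          (Y b lambda phi ((x + INR (u 1%nat)) / INR b) (shift_seq v) - Derive phi ((x + INR (u 1%nat)) / INR b)))
         with (Y b lambda phi ((x + INR (u 1%nat)) / INR b) (shift_seq u) - Y b lambda phi ((x + INR (u 1%nat)) / INR b) (shift_seq v)) by ring.
        rewrite HY.
        replace (q + / INR b ^ n * (INR (u 1%nat) / INR b) + / INR b ^ S n * x)
          with (q + / INR b ^ n * ((x + INR (u 1%nat)) / INR b)).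
        2:{ simpl. field. split; [apply pow_nonzero|]; lra. }
        simpl. ring.
Qed.

(** * Compactness of Sigma and uniform nondegeneracy *)

(** Sequential compactness of a product of finite sets: a prefix shared by infinitely many sequences
    is extended one letter at a time by the pigeonhole principle. *)
Lemma finite_alphabet_limit_point (T : Type) (L : list T) (s : nat -> nat -> T) :
  (forall i k, In (s i k) L) ->
  exists t : nat -> T, forall m N, exists i, (N <= i)%nat /\ forall k, (k < m)%nat -> s i k = t k.
Proof.
  intros HL.
  set (good := fun (m : nat) (t : nat -> T) =>
    forall N, exists i, (N <= i)%nat /\ forall k, (k < m)%nat -> s i k = t k).
  set (upd := fun (t : nat -> T) (m : nat) (d : T) (k : nat) => if Nat.eq_dec k m then d else t k).
  assert (Hpigeon : forall (P : nat -> Prop) (m : nat) (L : list T),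
    (forall N, exists i, (N <= i)%nat /\ P i /\ In (s i m) L) ->
    exists d, forall N, exists i, (N <= i)%nat /\ P i /\ s i m = d).
  { intros P m L'. induction L' as [|d L' IH]; intros H.
    - destruct (H 0%nat) as [i [_ [_ []]]].
    - destruct (classic (forall N, exists i, (N <= i)%nat /\ P i /\ s i m = d)) as [Hd|Hd].
      + exists d; exact Hd.
      + apply IH. apply not_all_ex_not in Hd. destruct Hd as [N0 HN0].
        intros N. destruct (H (Nat.max N N0)) as [i [Hi [HP [Hd|Hin]]]].
        * exfalso. apply HN0. exists i. repeat split; [lia|exact HP|symmetry; exact Hd].
        * exists i. repeat split; [lia|exact HP|exact Hin]. }
  assert (Hext : forall mt : nat * (nat -> T), exists d : T,
    good (fst mt) (snd mt) -> good (S (fst mt)) (upd (snd mt) (fst mt) d)).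
  { intros [m t]. simpl. destruct (classic (good m t)) as [Hg|Hg].
    - destruct (Hpigeon (fun i => forall k, (k < m)%nat -> s i k = t k) m L) as [d Hd].
      + intros N. destruct (Hg N) as [i [Hi Hk]]. exists i. auto.
      + exists d. intros _ N. destruct (Hd N) as [i [Hi [Hk Hm]]]. exists i. split; [exact Hi|].
        intros k Hkm. unfold upd. destruct (Nat.eq_dec k m) as [->|Hne]; [exact Hm|]. apply Hk; lia.
    - exists (s 0%nat 0%nat). intros H; contradiction. }
  apply functional_choice in Hext. destruct Hext as [d Hd].
  (* [F m] fixes the letters below m, and later stages leave them unchanged, so the diagonal k ->
     [F (S k) k] is the limit sequence. *)
  set (F := fix F (m : nat) : nat -> T :=
    match m with 0%nat => fun _ => s 0%nat 0%nat | S m' => upd (F m') m' (d (m', F m')) end).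
  assert (Hgood : forall m, good m (F m)).
  { induction m as [|m IH].
    - intros N. exists N. split; [lia|]. intros k Hk; lia.
    - apply (Hd (m, F m)). exact IH. }
  assert (Hstable : forall m k, (k < m)%nat -> F m k = F (S k) k).
  { induction m as [|m IH]; intros k Hk; [lia|].
    destruct (Nat.eq_dec k m) as [->|Hne]; [reflexivity|].
    rewrite <- (IH k) by lia. simpl. unfold upd at 1. destruct (Nat.eq_dec k m); [contradiction|reflexivity]. }
  exists (fun k => F (S k) k). intros m N. destruct (Hgood m N) as [i [Hi Hk]].
  exists i. split; [exact Hi|]. intros k Hkm. rewrite Hk by exact Hkm. apply Hstable; exact Hkm.
Qed.

Lemma Sigma_limit_point (b : nat) (u v : nat -> nat -> nat) (x : nat -> R) :
  (forall i, inSigma b (u i)) -> (forall i, inSigma b (v i)) -> (forall i, 0 <= x i <= 1) ->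
  exists u0 v0 x0, forall (m : nat) (eps : R), 0 < eps ->
    exists i, (m <= i)%nat /\ (forall k, (k <= m)%nat -> u i k = u0 k /\ v i k = v0 k) /\
      Rabs (x i - x0) < eps.
Proof.
  intros Hu Hv Hx.
  (* Pairs of letters form one finite alphabet, which makes [u] and [v] converge along the same
     indices. *)
  destruct (finite_alphabet_limit_point _ (list_prod (seq 0 b) (seq 0 b)) (fun i k => (u i k, v i k)))
    as [t Ht].
  { intros i k. apply in_prod; apply in_seq; split; try lia; [apply Hu|apply Hv]. }
  assert (H := fun m => Ht (S m) m). apply functional_choice in H. destruct H as [j Hj].
  destruct (Bolzano_Weierstrass_01 (fun m => x (j m))) as [x0 Hx0]; [intros; apply Hx|].
  exists (fun k => fst (t k)), (fun k => snd (t k)), x0.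
  intros m eps Heps. destruct (Hx0 eps m Heps) as [n [Hn Hxn]]. destruct (Hj n) as [Hjn Hk].
  exists (j n). split; [lia|]. split; [|exact Hxn].
  intros k Hkm. rewrite <- Hk by lia. split; reflexivity.
Qed.

Lemma pow_lt_eventually (B q eps : R) :
  0 <= B -> 0 <= q < 1 -> 0 < eps -> exists N, forall n, (N <= n)%nat -> B * q ^ n < eps.
Proof.
  intros HB Hq Heps.
  destruct (pow_lt_1_zero q) with (y := eps / (B + 1)) as [N HN].
  { rewrite Rabs_pos_eq; lra. }
  { apply Rdiv_lt_0_compat; lra. }
  exists N. intros n Hn. specialize (HN n Hn).
  assert (0 <= q ^ n) by (apply pow_le; lra). rewrite Rabs_pos_eq in HN by assumption.
  apply (Rmult_lt_compat_l (B + 1)) in HN; [|lra].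
  replace ((B + 1) * (eps / (B + 1))) with eps in HN by (field; lra). nra.
Qed.

(** If no [Q] and [c] work, some pairs have ever more and ever smaller coefficients. At a limit pair
    [u0], [v0], whose first letters still differ, the difference vanishes near [x0], hence
    everywhere, against condition (H). The limit is taken in values of Y, where continuity in the
    sequence is already known. *)
Lemma uniform_nondegeneracy (b : nat) (lambda : R) (phi : R -> R) (M K : R)
    (T : (nat -> nat) -> R -> nat -> R) :
  (2 <= b)%nat -> 0 < / (INR b * lambda) < 1 -> 0 < K ->
  (forall y, Rabs (Derive phi y) <= M) ->
  (forall w, has_expansion M K (fun x => Y b lambda phi x w) (T w)) ->
  condH b lambda phi ->
  exists (Q : nat) (c : R), 0 < c /\ forall u v x,
    inSigma b u -> inSigma b v -> u 1%nat <> v 1%nat -> 0 <= x <= 1 ->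
    exists k, (k <= Q)%nat /\ c <= Rabs (T u x k - T v x k).
Proof.
  set (g := / (INR b * lambda)). intros Hb Hg HK HM HT HH.
  assert (HM0 : 0 <= M) by (eapply Rle_trans; [apply Rabs_pos|apply (HM 0)]).
  apply NNPP. intros Hneg.
  (* The bound 1/(i+1)^2 lets the i + 1 terms of a Taylor polynomial of degree i sum to at most
     1/(i+1). *)
  assert (Hbad : forall i : nat, exists p : (nat -> nat) * (nat -> nat) * R,
    let '(u, v, x) := p in inSigma b u /\ inSigma b v /\ u 1%nat <> v 1%nat /\ 0 <= x <= 1 /\
      forall k, (k <= i)%nat -> Rabs (T u x k - T v x k) <= / (INR (S i) * INR (S i))).
  { intros i. apply NNPP. intros Hi. apply Hneg.
    assert (HS : 0 < INR (S i)) by (apply lt_0_INR; lia).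
    exists i, (/ (INR (S i) * INR (S i))). split; [apply Rinv_0_lt_compat; nra|].
    intros u v x Hu Hv Huv Hx. apply NNPP. intros Hk. apply Hi. exists (u, v, x).
    repeat split; try assumption; try apply Hu; try apply Hv; try apply Hx.
    intros k Hki. apply Rnot_lt_le. intros Hlt. apply Hk. exists k. split; [exact Hki|lra]. }
  apply functional_choice in Hbad. destruct Hbad as [p Hp].
  set (u := fun i => fst (fst (p i))). set (v := fun i => snd (fst (p i))). set (x := fun i => snd (p i)).
  assert (Hp' : forall i, inSigma b (u i) /\ inSigma b (v i) /\ u i 1%nat <> v i 1%nat /\ 0 <= x i <= 1 /\
      forall k, (k <= i)%nat -> Rabs (T (u i) (x i) k - T (v i) (x i) k) <= / (INR (S i) * INR (S i))).
  { intros i. specialize (Hp i). unfold u, v, x. destruct (p i) as [[ui vi] xi]. exact Hp. }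
  clear Hp. clearbody u v x.
  destruct (Sigma_limit_point b u v x) as (u0 & v0 & x0 & Hlim); try (intros; apply Hp').
  assert (Hu0 : inSigma b u0).
  { split.
    - destruct (Hlim 0%nat 1 ltac:(lra)) as [i [_ [Hi _]]]. destruct (Hi 0%nat ltac:(lia)) as [<- _].
      apply Hp'.
    - intros k. destruct (Hlim k 1 ltac:(lra)) as [i [_ [Hi _]]]. destruct (Hi k ltac:(lia)) as [<- _].
      apply Hp'. }
  assert (Hv0 : inSigma b v0).
  { split.
    - destruct (Hlim 0%nat 1 ltac:(lra)) as [i [_ [Hi _]]]. destruct (Hi 0%nat ltac:(lia)) as [_ <-].
      apply Hp'.
    - intros k. destruct (Hlim k 1 ltac:(lra)) as [i [_ [Hi _]]]. destruct (Hi k ltac:(lia)) as [_ <-].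
      apply Hp'. }
  assert (Huv0 : u0 1%nat <> v0 1%nat).
  { destruct (Hlim 1%nat 1 ltac:(lra)) as [i [_ [Hi _]]]. destruct (Hi 1%nat ltac:(lia)) as [<- <-].
    apply Hp'. }
  apply (HH v0 u0 Hv0 Hu0); [intros E; apply Huv0; rewrite E; reflexivity|].
  assert (HF := fun u v => has_expansion_minus _ _ _ _ _ _ (HT u) (HT v)). cbv beta in HF.
  (* Increments up to 1 have powers at most 1, and increments up to 1/(2K) make the remainder of
     order i decay like 2^-i. *)
  set (s := Rmin 1 (/ (2 * K))).
  assert (Hs : 0 < s) by (apply Rmin_pos; [lra|apply Rinv_0_lt_compat; lra]).
  apply (has_expansion_identity _ _ _ _ x0 HK (HF u0 v0)).
  apply (has_expansion_coef_vanish _ _ _ _ _ s HK Hs (HF u0 v0)).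
  intros y Hy. apply NNPP. intros Hne. apply Rabs_pos_lt in Hne.
  set (e := Rabs (Y b lambda phi y u0 - Y b lambda phi y v0)) in *.
  (* Three errors are made smaller than e/8: the Taylor polynomial, the remainder, and the change of
     sequence. The last occurs twice, so the total is below e/2. *)
  destruct (archimed_cor1 (e / 8)) as [N1 [HN1 HN1p]]; [lra|].
  destruct (pow_lt_eventually (2 * M) (/ 2) (e / 8)) as [N2 HN2]; try lra.
  assert (HC : 0 <= 2 * M / (1 - g)) by (apply Rdiv_le_0_compat; lra).
  destruct (pow_lt_eventually (2 * M / (1 - g)) g (e / 8)) as [N3 HN3]; try lra.
  destruct (Hlim (Nat.max N1 (Nat.max N2 N3)) (s - Rabs (y - x0))) as [i [Hi [Hpre Hxi]]]; [lra|].
  destruct (Hp' i) as (_ & _ & _ & _ & Hbad).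
  assert (Hh : Rabs (y - x i) <= s).
  { replace (y - x i) with ((y - x0) - (x i - x0)) by ring.
    eapply Rle_trans; [apply Rabs_triang|]. rewrite Rabs_Ropp. lra. }
  assert (Hs1 : s <= 1) by apply Rmin_l. assert (Hs2 : s <= / (2 * K)) by apply Rmin_r.
  assert (HSi : 0 < INR (S i)) by (apply lt_0_INR; lia).
  assert (HFi : Rabs (Y b lambda phi y (u i) - Y b lambda phi y (v i)) <= / INR (S i) + 2 * M * (/ 2) ^ S i).
  { destruct (HF (u i) (v i)) as [_ He]. specialize (He (x i) (y - x i) i).
    replace (x i + (y - x i)) with y in He by ring.
    assert (H1 : Rabs (sum_f_R0 (fun k => (T (u i) (x i) k - T (v i) (x i) k) * (y - x i) ^ k) i) <= / INR (S i)).
    { eapply Rle_trans; [apply Rsum_abs|].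
      replace (/ INR (S i)) with (INR (S i) * / (INR (S i) * INR (S i))) by (field; lra).
      apply sum_f_R0_const_bound. intros k Hk. rewrite Rabs_mult, <- RPow_abs.
      rewrite <- (Rmult_1_r (/ _)). apply Rmult_le_compat; try apply Rabs_pos; [apply pow_le, Rabs_pos|auto|].
      rewrite <- (pow1 k). apply pow_incr. split; [apply Rabs_pos|lra]. }
    assert (H2 : 2 * M * (K * Rabs (y - x i)) ^ S i <= 2 * M * (/ 2) ^ S i).
    { apply Rmult_le_compat_l; [lra|]. apply pow_incr. split.
      - apply Rmult_le_pos; [lra|apply Rabs_pos].
      - apply Rle_trans with (K * / (2 * K)); [apply Rmult_le_compat_l; lra|]. right; field; lra. }
    apply Rabs_le_between in H1. apply Rabs_le_between in He. apply Rabs_le_between. lra. }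
  set (m := Nat.max N1 (Nat.max N2 N3)) in *.
  assert (Hcu := Y_prefix_close b lambda phi M y u0 (u i) m Hg HM
    (fun k Hk => eq_sym (proj1 (Hpre k Hk)))).
  assert (Hcv := Y_prefix_close b lambda phi M y v0 (v i) m Hg HM
    (fun k Hk => eq_sym (proj2 (Hpre k Hk)))).
  fold g in Hcu, Hcv.
  assert (H3 := HN3 m ltac:(lia)). assert (H2 := HN2 (S i) ltac:(lia)).
  assert (H1 : / INR (S i) <= / INR N1).
  { apply Rinv_le_contravar; [apply lt_0_INR; lia|]. apply le_INR; lia. }
  assert (Hfin : e <= / INR (S i) + 2 * M * (/ 2) ^ S i + 2 * (2 * M / (1 - g) * g ^ m)).
  { unfold e. apply Rabs_le_between in HFi. apply Rabs_le_between in Hcu. apply Rabs_le_between in Hcv.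
    apply Rabs_le_between. lra. }
  lra.
Qed.

(** * Supremum and oscillation on small scales *)

Lemma pow_diff_lipschitz (k : nat) (x y : R) :
  0 <= x <= 1 -> 0 <= y <= 1 -> Rabs (x ^ k - y ^ k) <= INR k * Rabs (x - y).
Proof.
  intros Hx Hy. induction k as [|k IH].
  - simpl. rewrite Rminus_diag, Rabs_R0. lra.
  - rewrite S_INR. simpl.
    replace (x * x ^ k - y * y ^ k) with (x * (x ^ k - y ^ k) + (x - y) * y ^ k) by ring.
    eapply Rle_trans; [apply Rabs_triang|]. rewrite !Rabs_mult.
    rewrite (Rabs_pos_eq x) by lra.
    assert (0 <= y ^ k <= 1).
    { split; [apply pow_le; lra|]. rewrite <- (pow1 k). apply pow_incr; lra. }
    rewrite (Rabs_pos_eq (y ^ k)) by lra.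
    assert (H1 := Rabs_pos (x ^ k - y ^ k)). assert (H2 := Rabs_pos (x - y)).
    assert (x * Rabs (x ^ k - y ^ k) <= 1 * Rabs (x ^ k - y ^ k)) by (apply Rmult_le_compat_r; lra).
    assert (Rabs (x - y) * y ^ k <= Rabs (x - y) * 1) by (apply Rmult_le_compat_l; lra).
    lra.
Qed.

(* On a short interval [f] is a small perturbation of its Taylor polynomial of degree [Q],
   whose rescaled coefficients are controlled by its supremum; this gives both a lower bound for
   the supremum and a scale-invariant modulus of continuity.  On longer intervals the supremum
   is bounded below by the one at scale [d0], and the Lipschitz constant suffices. *)
Lemma rescaled_sup_and_oscillation (M K c : R) (Q : nat) :
  0 < M -> 0 < K -> 0 < c ->
  exists c1 eta : R, 0 < c1 /\ 0 < eta /\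
    forall (f : R -> R) (a : R -> nat -> R) (q d B : R),
    has_expansion M K f a -> 0 < d <= 1 ->
    (exists k, (k <= Q)%nat /\ c <= Rabs (a q k)) ->
    (forall x, 0 <= x <= 1 -> Rabs (f (q + d * x)) <= B) ->
    c1 * d ^ Q <= B /\
    forall x y, 0 <= x <= 1 -> 0 <= y <= 1 -> Rabs (x - y) <= eta ->
      Rabs (f (q + d * x) - f (q + d * y)) <= B / 2.
Proof.
  intros HM HK Hc. destruct (poly_coef_bound Q) as [C [HC HP]].
  set (L := M * K ^ S Q). assert (HL : 0 < L) by (apply Rmult_lt_0_compat; [lra|apply pow_lt; lra]).
  (* Below this scale the Taylor remainder, at most L d^(Q+1), is at most 1/32 of c0 d^Q, the lower
     bound to be proved for the supremum. *)
  set (d0 := Rmin 1 (c / (64 * (C + 1) * L))).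
  assert (Hd0 : 0 < d0).
  { apply Rmin_pos; [lra|]. apply Rdiv_lt_0_compat; [lra|]. apply Rmult_lt_0_compat; lra. }
  assert (Hd01 : d0 <= 1) by apply Rmin_l.
  assert (Hd02 : d0 <= c / (64 * (C + 1) * L)) by apply Rmin_r.
  assert (HQ : 0 < INR (S Q)) by (apply lt_0_INR; lia).
  set (c0 := c / (2 * (C + 1))). assert (Hc0 : 0 < c0) by (apply Rdiv_lt_0_compat; lra).
  assert (Hld0 : L * d0 <= c0 / 32).
  { apply Rle_trans with (L * (c / (64 * (C + 1) * L))); [apply Rmult_le_compat_l; [lra|exact Hd02]|].
    right. unfold c0. field. lra. }
  assert (Hshort : forall (f : R -> R) (a : R -> nat -> R) (q d B : R),
    has_expansion M K f a -> 0 < d <= d0 ->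
    (exists k, (k <= Q)%nat /\ c <= Rabs (a q k)) ->
    (forall x, 0 <= x <= 1 -> Rabs (f (q + d * x)) <= B) ->
    c0 * d ^ Q <= B /\
    forall x y, 0 <= x <= 1 -> 0 <= y <= 1 -> Rabs (x - y) <= / (8 * C * INR (S Q) * INR (S Q)) ->
      Rabs (f (q + d * x) - f (q + d * y)) <= B / 2).
  { intros f a q d B [_ He] Hd [k [Hk Hak]] HB.
    set (e := L * d * d ^ Q).
    assert (Hdq : 0 < d ^ Q) by (apply pow_lt; lra).
    assert (Hep : forall x, 0 <= x <= 1 ->
      Rabs (f (q + d * x) - sum_f_R0 (fun k => a q k * d ^ k * x ^ k) Q) <= e).
    { intros x Hx. specialize (He q (d * x) Q).
      rewrite (sum_eq _ (fun k => a q k * d ^ k * x ^ k)) in He by (intros; rewrite Rpow_mult_distr; ring).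
      eapply Rle_trans; [exact He|]. unfold e, L.
      replace (M * K ^ S Q * d * d ^ Q) with (M * (K * d) ^ S Q)
        by (rewrite Rpow_mult_distr; simpl; ring).
      apply Rmult_le_compat_l; [lra|]. rewrite (Rabs_pos_eq (d * x)) by nra.
      apply pow_incr. split; [apply Rmult_le_pos; nra|]. apply Rmult_le_compat_l; nra. }
    assert (Hcoef : forall j, (j <= Q)%nat -> Rabs (a q j * d ^ j) <= C * (B + e)).
    { apply (HP (fun j => a q j * d ^ j)). intros t Ht. specialize (Hep t Ht). specialize (HB t Ht).
      apply Rabs_le_between in Hep. apply Rabs_le_between in HB. apply Rabs_le_between. lra. }
    assert (Hee : e <= c0 / 32 * d ^ Q).
    { unfold e. apply Rmult_le_compat_r; [lra|]. apply Rle_trans with (2 := Hld0).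
      apply Rmult_le_compat_l; lra. }
    assert (HB0 : 0 <= B).
    { eapply Rle_trans; [apply Rabs_pos|apply (HB 0); lra]. }
    assert (He0 : 0 < e) by (unfold e; apply Rmult_lt_0_compat; [apply Rmult_lt_0_compat|]; lra).
    assert (Hlow : 2 * c0 * d ^ Q <= B + e).
    { specialize (Hcoef k Hk). rewrite Rabs_mult, (Rabs_pos_eq (d ^ k)) in Hcoef by (apply pow_le; lra).
      assert (Hdk : d ^ Q <= d ^ k).
      { replace Q with (k + (Q - k))%nat by lia. rewrite pow_add.
        assert (0 < d ^ k) by (apply pow_lt; lra).
        assert (d ^ (Q - k) <= 1) by (rewrite <- (pow1 (Q - k)); apply pow_incr; lra). nra. }
      assert (c * d ^ Q <= (C + 1) * (B + e)).
      { apply Rle_trans with (Rabs (a q k) * d ^ k).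
        - apply Rmult_le_compat; lra.
        - apply Rle_trans with (1 := Hcoef). apply Rmult_le_compat_r; lra. }
      apply (Rmult_le_reg_l (C + 1)); [lra|].
      apply Rle_trans with (2 := H). right. unfold c0. field. lra. }
    assert (HeB : e <= B / 16) by lra.
    split; [lra|].
    intros x y Hx Hy Hxy.
    (* There are Q + 1 terms, with coefficients at most 2CB and powers that are (Q+1)-Lipschitz on
       [0,1]; the bound on |x - y| makes the total B/4. The two remainders add at most B/8. *)
    assert (Hpoly : Rabs (sum_f_R0 (fun k => a q k * d ^ k * x ^ k) Q - sum_f_R0 (fun k => a q k * d ^ k * y ^ k) Q) <= B / 4).
    { rewrite <- minus_sum. eapply Rle_trans; [apply Rsum_abs|].
      apply Rle_trans with (INR (S Q) * (C * (2 * B) * (INR (S Q) * / (8 * C * INR (S Q) * INR (S Q))))).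
      - apply sum_f_R0_const_bound. intros j Hj.
        rewrite <- Rmult_minus_distr_l, Rabs_mult.
        apply Rmult_le_compat; try apply Rabs_pos.
        + apply Rle_trans with (1 := Hcoef j Hj). apply Rmult_le_compat_l; lra.
        + eapply Rle_trans; [apply pow_diff_lipschitz; assumption|].
          apply Rmult_le_compat; [apply pos_INR|apply Rabs_pos|apply le_INR; lia|exact Hxy].
      - right. field. lra. }
    assert (H1 := Hep x Hx). assert (H2 := Hep y Hy).
    apply Rabs_le_between in H1. apply Rabs_le_between in H2. apply Rabs_le_between in Hpoly.
    apply Rabs_le_between. lra. }
  set (S0 := c0 * d0 ^ Q).
  assert (HS0 : 0 < S0) by (apply Rmult_lt_0_compat; [lra|apply pow_lt; lra]).
  (* [S0] bounds the supremum below at scale [d0]. The second entry of the minimum makes the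
     Lipschitz bound at most S0/2 on longer intervals. *)
  exists S0, (Rmin (/ (8 * C * INR (S Q) * INR (S Q))) (S0 / (2 * M * K))).
  split; [exact HS0|]. split.
  { apply Rmin_pos; [apply Rinv_0_lt_compat|apply Rdiv_lt_0_compat; [lra|]];
      repeat apply Rmult_lt_0_compat; lra. }
  intros f a q d B Hf Hd Hk HB.
  destruct (Rle_lt_dec d d0) as [Hle|Hlt].
  - destruct (Hshort f a q d B Hf ltac:(lra) Hk HB) as [H1 H2]. split.
    + apply Rle_trans with (2 := H1). apply Rmult_le_compat_r; [apply pow_le; lra|].
      unfold S0. assert (d0 ^ Q <= 1) by (rewrite <- (pow1 Q); apply pow_incr; lra). nra.
    + intros x y Hx Hy Hxy. apply H2; try assumption.
      apply Rle_trans with (1 := Hxy). apply Rmin_l.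
  - assert (HS : S0 <= B).
    (* The initial piece of length [d0] lies in the given interval, so [B] bounds [f] there too. *)
    { apply (Hshort f a q d0 B Hf ltac:(lra) Hk). intros x Hx.
      replace (d0 * x) with (d * (d0 / d * x)) by (field; lra). apply HB.
      assert (0 < d0 / d) by (apply Rdiv_lt_0_compat; lra).
      assert (d0 / d <= 1).
      { apply (Rmult_le_reg_r d); [lra|]. unfold Rdiv. rewrite Rmult_assoc, Rinv_l; lra. }
      nra. }
    split.
    + assert (d ^ Q <= 1) by (rewrite <- (pow1 Q); apply pow_incr; lra).
      assert (0 < d ^ Q) by (apply pow_lt; lra). nra.
    + intros x y Hx Hy Hxy.
      eapply Rle_trans; [apply (has_expansion_lipschitz _ _ _ _ Hf)|].
      replace (q + d * x - (q + d * y)) with (d * (x - y)) by ring.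
      rewrite Rabs_mult, (Rabs_pos_eq d) by lra.
      apply Rle_trans with (M * K * (S0 / (2 * M * K))).
      * apply Rmult_le_compat_l; [nra|]. assert (H0 := Rabs_pos (x - y)).
        assert (Hr := Rmin_r (/ (8 * C * INR (S Q) * INR (S Q))) (S0 / (2 * M * K))).
        nra.
      * apply Rle_trans with (S0 / 2); [right; field; lra | lra].
Qed.

Lemma first_difference (u v : nat -> nat) (n : nat) :
  u 0%nat = v 0%nat -> u n <> v n ->
  exists m, (S m <= n)%nat /\ (forall k, (k <= m)%nat -> u k = v k) /\ u (S m) <> v (S m).
Proof.
  intros H0. induction n as [n IH] using lt_wf_ind. intros Hn.
  destruct n as [|n]; [contradiction|].
  destruct (classic (exists k, (k <= n)%nat /\ u k <> v k)) as [[k [Hk Hne]]|Hno].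
  - destruct (IH k ltac:(lia) Hne) as [m [Hm H]]. exists m. split; [lia|exact H].
  - exists n. split; [lia|]. split; [|exact Hn].
    intros k Hk. apply NNPP. intros Hne. apply Hno. exists k. auto.
Qed.

(** The rescaled estimate is applied after renormalizing to the first differing letter m + 1 <= n.
    Both conclusions are homogeneous in [B], so the factor gamma^m divides out; later [B] is the
    supremum itself. *)
Lemma dY_sup_and_oscillation (b : nat) (lambda : R) (phi : R -> R) :
  (2 <= b)%nat -> / INR b < lambda < 1 ->
  real_analytic phi -> Z_periodic phi -> condH b lambda phi ->
  exists (Q : nat) (c eta : R), 0 < c /\ 0 < eta /\
    forall (n : nat) (u v : nat -> nat) (B : R),
      inSigma b u -> inSigma b v -> u n <> v n ->
      (forall x, 0 <= x <= 1 -> dY b lambda phi u v x <= B) ->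
      c * / INR b ^ (S Q * n) <= B /\
      forall x y, 0 <= x <= 1 -> 0 <= y <= 1 -> Rabs (x - y) <= eta ->
        dY b lambda phi u v x - B / 2 <= dY b lambda phi u v y.
Proof.
  intros Hb Hl Ha Hp HH.
  assert (HB : 2 <= INR b) by (apply (le_INR 2); lia).
  set (g := / (INR b * lambda)).
  assert (Hbl : 1 < INR b * lambda <= INR b).
  { assert (INR b * / INR b < INR b * lambda) by (apply Rmult_lt_compat_l; lra).
    rewrite Rinv_r in H by lra. nra. }
  assert (Hg : 0 < g < 1).
  { unfold g. split; [apply Rinv_0_lt_compat; lra|]. rewrite <- Rinv_1 at 1. apply Rinv_lt_contravar; lra. }
  assert (Hgb : / INR b <= g) by (apply Rinv_le_contravar; lra).
  destruct (Derive_has_expansion phi Ha Hp) as (M & K & a & HM & HK & Hexp).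
  assert (Hpsi := has_expansion_bounded _ _ _ _ Hexp).
  set (M' := M / (1 - g)). assert (HM' : 0 < M') by (apply Rdiv_lt_0_compat; lra).
  assert (HMM : M <= M').
  { unfold M'. apply (Rmult_le_reg_r (1 - g)); [lra|]. unfold Rdiv. rewrite Rmult_assoc, Rinv_l by lra. nra. }
  assert (HT : forall w, has_expansion M' K (fun x => Y b lambda phi x w) (Ycoef b g a w)).
  { intros w. apply Y_has_expansion; assumption. }
  destruct (uniform_nondegeneracy b lambda phi M' K (Ycoef b g a)) as (Q & c & Hc & Hnd);
    try assumption.
  { intros y. eapply Rle_trans; [apply Hpsi|exact HMM]. }
  destruct (rescaled_sup_and_oscillation (2 * M') K c Q) as (c1 & eta & Hc1 & Heta & Hosc); try lra.
  exists Q, c1, eta. split; [exact Hc1|]. split; [exact Heta|].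
  intros n u v B Hu Hv Huv HBd.
  destruct (first_difference u v n) as (m & Hm & Heq & Hne); [|exact Huv|].
  { rewrite (proj1 Hu), (proj1 Hv). reflexivity. }
  destruct (Y_renormalize b lambda phi M m Hb Hg Hpsi u v Hu Hv Heq Hne)
    as (u' & v' & q & Hu' & Hv' & Hne' & Hq0 & Hq1 & HY).
  fold g in HY. set (d := / INR b ^ m) in *.
  assert (Hbm : 1 <= INR b ^ m) by (apply pow_R1_Rle; lra).
  assert (Hd : 0 < d <= 1).
  { unfold d. split; [apply Rinv_0_lt_compat; lra|]. rewrite <- Rinv_1. apply Rinv_le_contravar; lra. }
  assert (Hgm : 0 < g ^ m) by (apply pow_lt; lra).
  assert (HdY : forall x, dY b lambda phi u v x =
    g ^ m * Rabs (Y b lambda phi (q + d * x) u' - Y b lambda phi (q + d * x) v')).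
  { intros x. unfold dY. rewrite HY, Rabs_mult, Rabs_pos_eq by lra. reflexivity. }
  destruct (Hosc _ _ q d (B / g ^ m) (has_expansion_minus _ _ _ _ _ _ (HT u') (HT v')) Hd) as [Hlow Hos].
  { apply Hnd; try assumption. lra. }
  { intros x Hx. apply (Rmult_le_reg_l (g ^ m)); [exact Hgm|].
    rewrite <- HdY. replace (g ^ m * (B / g ^ m)) with B by (field; lra). apply HBd; exact Hx. }
  split.
  - apply Rle_trans with (g ^ m * (c1 * d ^ Q)).
    (* Since lambda < 1, gamma >= 1/b, so gamma^m costs at most one more power of b^-m. This
       explains the exponent [S Q]. *)
    + assert (Hdg : d <= g ^ m).
      { unfold d. rewrite <- pow_inv. apply pow_incr. split; [|exact Hgb].
        apply Rlt_le, Rinv_0_lt_compat; lra. }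
      assert (Hdn : / INR b ^ (S Q * n) <= d * d ^ Q).
      { change (d * d ^ Q) with (d ^ S Q). unfold d. rewrite pow_inv, <- pow_mult.
        apply Rinv_le_contravar; [apply pow_lt; lra|]. apply Rle_pow; [lra|]. nia. }
      assert (0 < d ^ Q) by (apply pow_lt; lra).
      apply Rle_trans with (c1 * (d * d ^ Q)); [apply Rmult_le_compat_l; lra|].
      replace (g ^ m * (c1 * d ^ Q)) with (c1 * (g ^ m * d ^ Q)) by ring.
      apply Rmult_le_compat_l; [lra|]. apply Rmult_le_compat_r; lra.
    + apply Rmult_le_compat_l with (r := g ^ m) in Hlow; [|lra].
      replace (g ^ m * (B / g ^ m)) with B in Hlow by (field; lra). exact Hlow.
  - intros x y Hx Hy Hxy. specialize (Hos x y Hx Hy Hxy). rewrite !HdY.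
    eapply Rle_trans in Hos; [|apply Rabs_triang_inv].
    apply Rmult_le_compat_l with (r := g ^ m) in Hos; [|lra].
    replace (g ^ m * (B / g ^ m / 2)) with (B / 2) in Hos by (field; lra). lra.
Qed.

(** * From one good cell to the sum over the partition *)

(** Closed cells are used because the near-maximal point may be 1, which lies in no half-open cell
    inside [0,1). *)
Lemma grid_interval (N : nat) (x : R) :
  (0 < N)%nat -> 0 <= x <= 1 ->
  exists j, (j <= N - 1)%nat /\ INR j / INR N <= x <= INR (S j) / INR N.
Proof.
  intros HN Hx. assert (HNp : 0 < INR N) by (apply lt_0_INR; lia).
  assert (H : forall m, x <= INR (S m) / INR N ->
    exists j, (j <= m)%nat /\ INR j / INR N <= x <= INR (S j) / INR N).
  { induction m as [|m IH]; intros Hm.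
    - exists 0%nat. split; [lia|]. split; [simpl; unfold Rdiv; lra|exact Hm].
    - destruct (Rle_lt_dec x (INR (S m) / INR N)) as [H|H].
      + destruct (IH H) as [j [Hj Hjx]]. exists j. split; [lia|exact Hjx].
      + exists (S m). split; [lia|]. split; [lra|exact Hm]. }
  apply H. replace (S (N - 1)) with N by lia. replace (INR N / INR N) with 1 by (field; lra). lra.
Qed.

(** [real] sends infinite values to 0, so finiteness matters: the infimum lies between [r] and the
    value at the left endpoint. *)
Lemma real_inf_co_ge (f : R -> R) (a c r : R) :
  a < c -> (forall x, a <= x < c -> r <= f x) -> r <= real (inf_co f a c).
Proof.
  intros Hac Hr. unfold inf_co.
  destruct (Glb_Rbar_correct (fun y => exists x, a <= x < c /\ y = f x)) as [H1 H2].
  assert (Hge : Rbar_le r (Glb_Rbar (fun y => exists x, a <= x < c /\ y = f x))).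
  { apply H2. intros y [x [Hx ->]]. apply Hr; exact Hx. }
  assert (Hle : Rbar_le (Glb_Rbar (fun y => exists x, a <= x < c /\ y = f x)) (f a)).
  { apply H1. exists a. split; [lra|reflexivity]. }
  destruct (Glb_Rbar (fun y => exists x, a <= x < c /\ y = f x)); simpl in *; tauto.
Qed.

Lemma sum_n_ge_term (a : nat -> R) (N j : nat) (r : R) :
  (forall k, 0 <= a k) -> (j <= N)%nat -> r <= a j -> r <= sum_n a N.
Proof.
  intros Ha Hj Hr. rewrite sum_n_Reals. induction N as [|N IH].
  - replace j with 0%nat in Hr by lia. exact Hr.
  - simpl. specialize (Ha (S N)) as HaN. destruct (Nat.eq_dec j (S N)) as [->|Hne].
    + assert (0 <= sum_f_R0 a N) by (apply cond_pos_sum; exact Ha). lra.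
    + specialize (IH ltac:(lia)). lra.
Qed.

Theorem mainTheorem15 (b : nat) (lambda : R) (phi : R -> R) :
  (2 <= b)%nat ->
  / INR b < lambda < 1 ->
  real_analytic phi ->
  Z_periodic phi ->
  condH b lambda phi ->
  exists (l0 Q0 : nat) (rho0 : R),
    (0 < l0)%nat /\ (0 < Q0)%nat /\ 0 < rho0 /\
    forall (n : nat) (u v : nat -> nat),
      (1 <= n)%nat -> inSigma b u -> inSigma b v -> u n <> v n ->
      Rbar_le (Finite (rho0 * / (INR b) ^ (Q0 * n)))
              (sup_co01 (dY b lambda phi u v)) /\
      Rbar_le (Rbar_mult (Finite rho0) (sup_cc01 (dY b lambda phi u v)))
              (Finite (sum_inf_Ll b l0 (dY b lambda phi u v))).
Proof.
  intros Hb Hl Ha Hp HH.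
  destruct (dY_sup_and_oscillation b lambda phi Hb Hl Ha Hp HH) as (Q & c & eta & Hc & Heta & Hmain).
  assert (HB : 2 <= INR b) by (apply (le_INR 2); lia).
  assert (Hinvb : 0 < / INR b < 1).
  { split; [apply Rinv_0_lt_compat; lra|]. rewrite <- Rinv_1 at 1. apply Rinv_lt_contravar; lra. }
  (* Cells must be shorter than [eta]; passing to [S l] keeps [l0] positive. *)
  destruct (pow_lt_eventually 1 (/ INR b) eta) as [l Hlpow]; try lra.
  set (l0 := S l).
  assert (Hl0 : / INR b ^ l0 < eta).
  { rewrite <- pow_inv. specialize (Hlpow l0 ltac:(unfold l0; lia)). lra. }
  assert (HbN : INR b ^ l0 = INR (b ^ l0)) by (rewrite pow_INR; reflexivity).
  set (N := (b ^ l0)%nat) in *.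
  assert (HN : (0 < N)%nat) by (assert (H := Nat.pow_nonzero b l0); unfold N; lia).
  assert (HNp : 0 < INR N) by (apply lt_0_INR; lia).
  (* 1/4 is the fraction of the supremum kept on one whole cell; c/8 lies below c/4, the constant
     this gives in the lower bound over [0,1). *)
  exists l0, (S Q), (Rmin (/ 4) (c / 8)).
  assert (Hr1 := Rmin_l (/ 4) (c / 8)). assert (Hr2 := Rmin_r (/ 4) (c / 8)).
  assert (Hr0 : 0 < Rmin (/ 4) (c / 8)) by (apply Rmin_pos; lra).
  set (rho := Rmin (/ 4) (c / 8)) in *.
  split; [unfold l0; lia|]. split; [lia|]. split; [exact Hr0|].
  intros n u v Hn Hu Hv Huv.
  set (f := dY b lambda phi u v).
  assert (Hf0 : forall x, 0 <= f x) by (intros; apply Rabs_pos).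
  destruct (Derive_has_expansion phi Ha Hp) as (M & K & a & HM & HK & Hexp).
  assert (Hpsi := has_expansion_bounded _ _ _ _ Hexp).
  assert (Hg : 0 < / (INR b * lambda) < 1).
  { assert (INR b * / INR b < INR b * lambda) by (apply Rmult_lt_compat_l; lra).
    rewrite Rinv_r in H by lra.
    split; [apply Rinv_0_lt_compat; lra|]. rewrite <- Rinv_1 at 1. apply Rinv_lt_contravar; lra. }
  assert (Hbd : exists D, forall x, f x <= D).
  (* An empty common prefix already gives a uniform bound, so the supremum is a real number. *)
  { exists (2 * M / (1 - / (INR b * lambda)) * (/ (INR b * lambda)) ^ 0). intros x.
    apply Y_prefix_close; [exact Hg|exact Hpsi|].
    intros k Hk. replace k with 0%nat by lia. rewrite (proj1 Hu), (proj1 Hv). reflexivity. }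
  destruct Hbd as [D HD].
  assert (Hsup := Lub_Rbar_correct (fun y => exists x, 0 <= x <= 1 /\ y = f x)).
  fold (sup_cc01 f) in Hsup. destruct Hsup as [Hub Hlub].
  assert (Hle : Rbar_le (sup_cc01 f) D).
  { apply Hlub. intros y [x [_ ->]]. apply HD. }
  assert (Hge : Rbar_le (f 0) (sup_cc01 f)).
  { apply Hub. exists 0. split; [lra|reflexivity]. }
  destruct (sup_cc01 f) as [B| |]; simpl in Hle, Hge; try tauto.
  assert (HfB : forall x, 0 <= x <= 1 -> f x <= B).
  { intros x Hx. apply (Hub (f x)). exists x. auto. }
  destruct (Hmain n u v B Hu Hv Huv HfB) as [Hlow Hosc].
  assert (HBp : 0 < B).
  { apply Rlt_le_trans with (2 := Hlow). apply Rmult_lt_0_compat; [lra|].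
    apply Rinv_0_lt_compat, pow_lt; lra. }
  assert (Hx : exists x, 0 <= x <= 1 /\ 3 / 4 * B <= f x).
  { apply NNPP. intros Hno.
    assert (Hc' : Rbar_le B (3 / 4 * B)).
    { apply Hlub. intros y [x [Hx ->]]. simpl. apply Rnot_lt_le. intros Hlt.
      apply Hno. exists x. split; [exact Hx|lra]. }
    simpl in Hc'. lra. }
  destruct Hx as [x [Hx Hfx]].
  destruct (grid_interval N x HN Hx) as [j [Hj Hjx]].
  assert (HiN : / INR N < eta) by (rewrite <- HbN; exact Hl0).
  assert (HiN0 : 0 < / INR N) by (apply Rinv_0_lt_compat; lra).
  assert (Hj0 : 0 <= INR j / INR N).
  { apply Rdiv_le_0_compat; [apply pos_INR|lra]. }
  assert (Hj1 : INR (S j) / INR N <= 1).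
  { apply (Rmult_le_reg_r (INR N)); [lra|]. unfold Rdiv. rewrite Rmult_assoc, Rinv_l by lra.
    rewrite Rmult_1_r, Rmult_1_l. apply le_INR. lia. }
  assert (HSj : INR (S j) / INR N = INR j / INR N + / INR N) by (rewrite S_INR; field; lra).
  (* 3B/4 at [x], less an oscillation of at most B/2 across the cell, leaves B/4. *)
  assert (Hcell : forall y, INR j / INR N <= y < INR (S j) / INR N -> B / 4 <= f y).
  { intros y Hy. assert (H := Hosc x y Hx ltac:(lra)). fold f in H.
    assert (Hxy : Rabs (x - y) <= eta) by (apply Rabs_le_between; lra).
    specialize (H Hxy). lra. }
  split.
  (* The left endpoint of the good cell lies in [0,1) and witnesses the supremum over the half-open
     interval. *)
  - apply Rbar_le_trans with (f (INR j / INR N)).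
    + assert (HB4 := Hcell (INR j / INR N) ltac:(lra)).
      assert (Hip : 0 < / INR b ^ (S Q * n)) by (apply Rinv_0_lt_compat, pow_lt; lra).
      change (rho * / INR b ^ (S Q * n) <= f (INR j / INR N)).
      apply Rle_trans with (c / 8 * / INR b ^ (S Q * n)); [apply Rmult_le_compat_r; lra|]. lra.
    + apply Lub_Rbar_correct. exists (INR j / INR N). split; [lra|reflexivity].
  - change (rho * B <= sum_inf_Ll b l0 f). unfold sum_inf_Ll. rewrite HbN. fold N.
    apply (sum_n_ge_term _ _ j).
    + intros k. apply real_inf_co_ge; [|intros; apply Hf0].
      unfold Rdiv. apply Rmult_lt_compat_r; [exact HiN0|]. apply lt_INR; lia.
    + exact Hj.
    + apply Rle_trans with (B / 4).
      * apply Rle_trans with (/ 4 * B); [apply Rmult_le_compat_r; lra|lra].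
      * apply real_inf_co_ge; [lra|exact Hcell].
Qed.
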